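(* Assume that $\{b_{n,r,s},\ r,s\in\mathbb{Z}\}$ is a sequence of positive numbers with $\rho_n^2\to0$ as $n\to\infty$, and that $\xi_0$ satisfies, for a certain constant $t>2$, the right-tail condition $$\mathbb{P}(\xi_0\ge x)=\frac{h(x)}{x^t}\quad\text{as } x\to\infty,$$ where $h$ is a slowly varying function at infinity. For $x=x_n\ge C_t[\ln(U_{nt}^{-1})]^{1/2}$, where $C_t>e^{t/2}(t+2)/\sqrt2$ is a constant, we have, as $n\to\infty$, $$\mathbb{P}(S_n\ge x)=(1+o(1))\sum_{r,s\in\mathbb{Z}}\mathbb{P}\big(b_{n,r,s}\xi_{-r,-s}\ge x\big)=(1+o(1))\,x^{-t}\sum_{r,s\in\mathbb{Z}}b_{n,r,s}^t\,h\Big(\frac{x}{b_{n,r,s}}\Big).$$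
   Context: Let $\{a_{r,s}\}_{(r,s)\in\mathbb{Z}^2}$ be a square summable family of real constants and let $\{\xi_{r,s}\}_{(r,s)\in\mathbb{Z}^2}$ and $\xi_0$ be i.i.d. real random variables on a probability space $(\Omega,\mathcal F,\mathbb P)$ with $\mathbb{E}\xi_0=0$ and $\mathbb{E}\xi_0^2=1$. The linear random field is $X_{j,k}=\sum_{r,s\in\mathbb{Z}}a_{r,s}\xi_{j-r,k-s}$, $(j,k)\in\mathbb{Z}^2$ (the series converges in $L^2(\Omega,\mathbb P)$ and almost surely). Let $\{\Gamma_n\}$ be a sequence of finite subsets of $\mathbb{Z}^2$ and $$S_n=\sum_{(j,k)\in\Gamma_n}X_{j,k}=\sum_{r,s\in\mathbb{Z}}b_{n,r,s}\xi_{-r,-s},\qquad b_{n,r,s}=\sum_{(j,k)\in\Gamma_n}a_{j+r,k+s}.$$ Put $D_{nt}=\sum_{r,s\in\mathbb{Z}}|b_{n,r,s}|^t$ and $U_{nt}=(D_{n2})^{-t/2}D_{nt}$. Put $\sigma_n^2=\mathbb{E}S_n^2=D_{n2}$, with $\sigma_n>0$ for every $n$, and $\rho_n^2=\max_{r,s\in\mathbb{Z}}b_{n,r,s}^2/\sigma_n^2$. A function $h$ is slowly varying at infinity if it is measurable and positive and $\lim_{x\to\infty}h(\lambda x)/h(x)=1$ for all constants $\lambda>0$. The left tail of $\xi_0$ can be arbitrary.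
   Formalization: The bound is imposed in units of σ_n, i.e. x_n ≥ C_t σ_n [ln(U_nt^{-1})]^{1/2}; without σ_n the claim fails, e.g. for a_{r,s}=2^{-|r|-|s|}, Γ_n=[0,n]^2, x_n = C_t[ln(U_nt^{-1})]^{1/2}, where the sum of tails tends to infinity. *)

(* Defs.v *)
From HB Require Import structures.
From mathcomp Require Import all_boot all_order all_algebra finmap.
From mathcomp Require Import all_classical all_reals all_analysis.
From mathcomp.analysis.showcase Require summability.

Set Implicit Arguments.
Unset Strict Implicit.
Unset Printing Implicit Defensive.

Import Order.TTheory GRing.Theory Num.Theory.
Import numFieldNormedType.Exports.

Local Open Scope classical_set_scope.
Local Open Scope ring_scope.

(* Indices are added componentwise, by the product zmodType structure. *)
Notation Z2 := (int * int)%type.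

Definition mutually_independent (d : measure_display) (T : measurableType d)
    (R : realType) (P : probability T R) (I : choiceType)
    (Y : I -> {RV P >-> R}) : Prop :=
  forall (J : {fset I}) (A : I -> set R),
    (forall i, measurable (A i)) ->
    P (\bigcap_(i in [set` J]) (Y i @^-1` A i)) =
    (\prod_(i <- J) P (Y i @^-1` A i))%E.

Definition identically_distributed (d : measure_display) (T : measurableType d)
    (R : realType) (P : probability T R) (I : Type)
    (Y : I -> {RV P >-> R}) : Prop :=
  forall (i j : I) (A : set R), measurable A ->
    distribution P (Y i) A = distribution P (Y j) A.

Definition iid (d : measure_display) (T : measurableType d)
    (R : realType) (P : probability T R) (I : choiceType)
    (Y : I -> {RV P >-> R}) : Prop :=
  mutually_independent Y /\ identically_distributed Y.

(* Z is a version of the sum of the family Y in L^2(P), the limit being taken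
   along the finite subsets of I ordered by inclusion. *)
Definition L2_sum (d : measure_display) (T : measurableType d)
    (R : realType) (P : probability T R) (I : choiceType)
    (Y : I -> T -> R) (Z : T -> R) : Prop :=
  (fun A : {fset I} => 'E_P[fun w => ((Z w - \sum_(i <- A) Y i w) ^+ 2)%R]%E)
    @ summability.totally --> 0%E.

Definition slowly_varying (R : realType) (h : R -> R) : Prop :=
  [/\ measurable_fun (`]0, +oo[%classic : set R) h,
      forall x : R, 0 < x -> 0 < h x &
      forall lambda : R, 0 < lambda ->
        h (lambda * x) / h x @[x --> +oo] --> (1 : R)].

(* u = (1 + o(1)) v as n tends to infinity *)
Definition asymp_eq (R : realType) (u v : nat -> \bar R) : Prop :=
  exists2 e : nat -> R, e n @[n --> \oo] --> (0 : R) &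
    \forall n \near \oo, u n = ((1 + e n)%:E * v n)%E.

Section LinearField.
Context {R : realType}.
Variables (a : Z2 -> R) (Gamma : nat -> {fset Z2}).

Definition coef (n : nat) (rs : Z2) : R := \sum_(jk <- Gamma n) a (jk + rs).

(* D_{nt}: finite for t >= 2, since [a] is square summable; this is the only
   range in which it is used, so [fine] loses nothing. *)
Definition coef_D (n : nat) (t : R) : R :=
  fine (\esum_(rs in [set: Z2]) (`|coef n rs| `^ t)%:E).

Definition coef_U (n : nat) (t : R) : R :=
  coef_D n 2 `^ (- (t / 2)) * coef_D n t.

(* Since [coef_U] is invariant under rescaling the coefficients, while the
   deviation probabilities are not, a threshold x_n has to be compared with
   powers of ln (1 / U_{nt}) in units of [sigma n], that is through
   x_n / sigma n. *)
Definition sigma (n : nat) : R := Num.sqrt (coef_D n 2).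

(* The supremum is attained, the squares [coef n rs ^+ 2] being summable. *)
Definition rho2 (n : nat) : R :=
  sup (range (fun rs : Z2 => coef n rs ^+ 2 / sigma n ^+ 2)).

End LinearField.

(* Main.v *)
Require Import Defs.
From HB Require Import structures.
From mathcomp Require Import all_boot all_order all_algebra finmap.
From mathcomp Require Import all_classical all_reals all_analysis.
From mathcomp Require Import measurable_realfun ring lra.
From mathcomp.analysis.showcase Require summability.

Set Implicit Arguments.
Unset Strict Implicit.
Unset Printing Implicit Defensive.

Import Order.TTheory GRing.Theory Num.Theory.
Import numFieldNormedType.Exports.
Import HBNNSimple.

Local Open Scope classical_set_scope.
Local Open Scope ring_scope.

(** Write [b] for the coefficients of S_n, [c = b / sigma_n] for the normalised
    weights, so that the squares of the [c] add up to 1, [y = x_n / sigma_n]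
    for the threshold, [G] for the right tail of the innovations and [V = sum
    G(y / c)] for the sum of the individual tail probabilities. The claim is
    the principle of a single big jump: S_n / sigma_n exceeds [y] because
    exactly one summand [c xi] does, all others contributing a sum of order 1,
    negligible against [y].

    _Lower bound_ ([pr_sum_ge_lower]). It suffices that some summand exceeds
    [(1 + delta) y] while the rest of the sum stays below [delta y] in absolute
    value. The rest is independent of the summand and has variance at most 1,
    so Chebyshev's inequality costs a factor [1 - O(y^-2)] only, and the
    overlaps of these events are at most [V ^ 2 = o(V)] by Bonferroni's
    inequality.

    _Upper bound_ ([pr_sum_ge_split]). If the sum exceeds [y], then some
    summand exceeds [(1 - delta) y], or some summand exceeds [eps y] while the
    rest exceeds [delta y] (again [O(y^-2) V] by Chebyshev), or no summand
    exceeds [eps y]. The last event is handled by an exponential moment of the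
    truncated summands ([pr_sum_no_big_jump]). With [U = sum c^t] and the
    parameter [lambda = 2 L / y], where [L = 2 ln(1/U) + (2t - 1) ln y], its
    probability is at most [e^(1 - L) = e U^2 y^(-(2t-1))]
    ([chernoff_exponent_le]). The quadratic term of the exponent is of order
    [L^2 / y^2], and it is here that [y] has to exceed a multiple of
    [sqrt(ln(1/U))]: the multiple 5 is enough, and the constant of the theorem
    is larger ([constant_ge]). On the other hand [G u >= A u^(-(2t-2))] for
    large [u], and the Cauchy-Schwarz inequality gives [sum c^(2t-2) >= U^2],
    so [V >= (A/2) U^2 y^(-(2t-2))] ([weighted_tail_ge]) and the last event is
    [o(V)].

    The tail enters only through [G] being monotone and regularly varying with
    index [- t]: this gives power bounds on [G] from iterated doubling
    ([doubling_bound]), and shows that replacing [y] by [(1 +- delta)^2 y]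
    changes each [G (y / c)] by a factor close to 1, uniformly in the summand
    because [y / c] is uniformly large ([tail_perturb]).

    All probability estimates are made for finite sums. They pass to S_n since
    S_n is an L^2 limit of finite sums: for a fixed [n] the error of a fine
    enough finite sum is negligible against [V]. [single_big_jump] states the
    outcome uniformly in the weights, and the theorem follows because [rho_n ->
    0] makes all weights small. Independence enters through the product rule
    for two jumps ([pr_two_jumps]) and the factorisation of expectations
    ([expectation_prod]). *)

(** * Independence and expectations of products *)
Section Independence.
Context {R : realType} {d : measure_display} {Omega : measurableType d}
  {P : probability Omega R}.

(** From events to functions: decorrelation from the indicators of [Z] extends
    to simple functions by linearity, then to nonnegative functions by monotone
    convergence. *)
Lemma ge0_integral_indep (g : Omega -> R) (Z : {RV P >-> R}) (f : R -> R) :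
  measurable_fun setT g -> (forall w, 0 <= g w) ->
  (\int[P]_w (g w)%:E \is a fin_num)%E ->
  (forall B, measurable B ->
    \int[P]_w (g w * \1_B (Z w))%:E = \int[P]_w (g w)%:E * P (Z @^-1` B))%E ->
  measurable_fun setT f -> (forall u, 0 <= f u) ->
  (\int[P]_w (g w * f (Z w))%:E =
    \int[P]_w (g w)%:E * \int[P]_w (f (Z w))%:E)%E.
Proof.
move=> mg g0 gfin gB mf f0.
have Ig0 : (0 <= \int[P]_w (g w)%:E)%E.
  by apply: integral_ge0 => w _; rewrite lee_fin.
have simple (k : {nnsfun R >-> R}) :
  (\int[P]_w (g w * k (Z w))%:E =
    \int[P]_w (g w)%:E * \int[P]_w (k (Z w))%:E)%E.
  have mk r : measurable_fun [set: Omega]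
      (fun w => \1_(k @^-1` [set r]) (Z w) : R).
    by apply: measurableT_comp.
  have rk0 r u : 0 <= r * \1_(k @^-1` [set r]) u.
    by rewrite -lee_fin EFinM nnfun_muleindic_ge0.
  have kE w : (k (Z w))%:E =
      (\sum_(r \in range k) (r * \1_(k @^-1` [set r]) (Z w))%:E)%E.
    by rewrite fimfunE -fsumEFin.
  rewrite (eq_integral _ _ (fun w _ => kE w)).
  rewrite [LHS](eq_integral (fun w => \sum_(r \in range k)
      ((g w)%:E * (r * \1_(k @^-1` [set r]) (Z w))%:E))%E); last first.
    by move=> w _; rewrite EFinM kE ge0_mule_fsumr// => r; rewrite lee_fin.
  rewrite !ge0_integral_fsum//; last 4 first.
  - by move=> r; apply/measurable_EFinP; apply: measurable_funM.
  - by move=> r w _; rewrite lee_fin.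
  - move=> r; under eq_fun do rewrite -EFinM.
    by apply/measurable_EFinP; do 2 apply: measurable_funM => //.
  - by move=> r w _; rewrite mule_ge0// lee_fin.
  rewrite ge0_mule_fsumr; last first.
    by move=> r; apply: integral_ge0 => w _; rewrite lee_fin.
  apply: eq_fsbigr => r rk.
  have r0 : (0 <= r%:E)%E.
    by move: rk; rewrite inE => -[u _ <-]; rewrite lee_fin.
  under [LHS]eq_integral do rewrite -EFinM mulrCA EFinM.
  under [in RHS]eq_integral do rewrite EFinM.
  rewrite ge0_integralZl//; last 2 first.
  - by apply/measurable_EFinP/measurable_funM.
  - by move=> w _; rewrite lee_fin mulr_ge0.
  rewrite gB// ge0_integralZl//; last exact/measurable_EFinP.
  rewrite muleCA; congr (_ * (_ * _))%E.
  rewrite -[RHS]/(\int[P]_w (\1_(Z @^-1` (k @^-1` [set r])) w)%:E)%E.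
  by rewrite integral_indic// ?setIT// -[X in measurable X]setTI;
    exact: measurable_funP.
have mEf : measurable_fun [set: R] (EFin \o f) by exact/measurable_EFinP.
pose f_ := nnsfun_approx measurableT mEf.
have fE u : ((f_ n u)%:E @[n --> \oo] --> (f u)%:E)%E.
  by apply: (@cvg_nnsfun_approx _ _ _ _ measurableT _ mEf) => // x _;
    rewrite lee_fin.
have f_nd u : {homo (fun n => f_ n u) : m n / (m <= n)%N >-> m <= n}.
  by move=> m n mn; have /lefP := nd_nnsfun_approx measurableT mEf mn.
have mf_ n : measurable_fun setT (fun w => f_ n (Z w)) by exact:
  measurableT_comp.
have -> : (\int[P]_w (f (Z w))%:E =
  limn (fun n => \int[P]_w (f_ n (Z w))%:E))%E.
  rewrite -monotone_convergence//.
  - by apply: eq_integral => w _; apply/esym/cvg_lim => //; exact: fE.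
  - by move=> n; exact/measurable_EFinP.
  - by move=> n w _; rewrite lee_fin.
  - by move=> w _ m n mn; rewrite lee_fin f_nd.
have -> : (\int[P]_w (g w * f (Z w))%:E =
    limn (fun n => \int[P]_w (g w * f_ n (Z w))%:E))%E.
  rewrite -monotone_convergence//.
  - apply: eq_integral => w _; apply/esym/cvg_lim => //; rewrite EFinM.
    by under eq_fun do rewrite EFinM; apply: cvgeZl => //; exact: fE.
  - by move=> n; apply/measurable_EFinP; exact: measurable_funM.
  - by move=> n w _; rewrite lee_fin mulr_ge0.
  - by move=> w _ m n mn; rewrite lee_fin ler_wpM2l// f_nd.
under [in LHS]eq_fun do rewrite simple.
apply/cvg_lim => //; apply: cvgeZl => //.
apply: ereal_nondecreasing_is_cvgn => m n mn.
apply: ge0_le_integral => //.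
- by move=> w _; rewrite lee_fin.
- exact/measurable_EFinP.
- exact/measurable_EFinP.
- by move=> w _; rewrite lee_fin f_nd.
Qed.

Context {I : choiceType} {Y : I -> {RV P >-> R}}.
Hypothesis indepY : mutually_independent Y.

(** The induction is on a list [J] outside which every factor is an indicator.
    For the empty list this is the product rule for events; enlarging [J] by one
    index replaces one indicator by a function, which is
    [ge0_integral_indep]. *)
Lemma ge0_integral_prod (A : {fset I}) (f : I -> R -> R) :
  (forall i, measurable_fun setT (f i)) -> (forall i u, 0 <= f i u) ->
  (forall i, \int[P]_w (f i (Y i w))%:E \is a fin_num)%E ->
  (\int[P]_w (\prod_(i <- A) f i (Y i w))%R%:E =
   \prod_(i <- A) \int[P]_w (f i (Y i w))%:E)%E.
Proof.
move=> mf f0 ff.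
have integral_ind B i : measurable B ->
    (\int[P]_w (\1_B (Y i w))%:E = P (Y i @^-1` B))%E.
  move=> mB; rewrite -[LHS]/(\int[P]_w (\1_(Y i @^-1` B) w)%:E)%E.
  by rewrite integral_indic// ?setIT// -[X in measurable X]setTI;
    exact: measurable_funP.
have fin_ind B i : measurable B ->
    (\int[P]_w (\1_B (Y i w))%:E \is a fin_num)%E.
  by move=> mB; rewrite integral_ind// fin_num_measure//
    -[X in measurable X]setTI; exact: measurable_funP.
suff {f mf f0 ff} indJ (J : seq I) (f : I -> R -> R) :
    (forall i, measurable_fun setT (f i)) -> (forall i u, 0 <= f i u) ->
    (forall i, \int[P]_w (f i (Y i w))%:E \is a fin_num)%E ->
    (forall i, i \notin J -> exists2 B, measurable B & f i = \1_B) ->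
    (\int[P]_w (\prod_(i <- A) f i (Y i w))%R%:E =
     \prod_(i <- A) \int[P]_w (f i (Y i w))%:E)%E.
  pose f' i : R -> R := if i \in A then f i else \1_setT.
  transitivity (\int[P]_w (\prod_(i <- A) (f' i (Y i w)))%R%:E)%E.
    by apply: eq_integral => w _; congr EFin; apply: eq_big_seq => i iA;
      rewrite /f' iA.
  rewrite (indJ A) /f'.
  - by apply: eq_big_seq => i iA; rewrite iA.
  - by move=> i; case: ifP => // _; apply: measurable_indic.
  - by move=> i u; case: ifP.
  - move=> i; case: ifP => // _; exact: fin_ind.
  - by move=> i /negbTE->; exists setT.
elim: J f => [|j J IH] f mf f0 ff indf.
  have /choice[B BP] i : exists B, measurable B /\ f i = \1_B.
    by have [//|B mB fB] := indf i; exists B.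
  transitivity (P (\bigcap_(i in [set` A]) (Y i @^-1` B i))).
    have mYB i : measurable (Y i @^-1` B i).
      by have [mB _] := BP i; rewrite -[X in measurable X]setTI;
        exact: measurable_funP.
    rewrite -[X in P X]setIT -integral_indic//; last first.
      apply: fin_bigcap_measurable => //.
    apply: eq_integral => w _; congr EFin; rewrite indicE.
    case: (boolP (w \in _)) => [|]; rewrite ?inE ?notin_setE => wB.
      rewrite big1_seq// => i /andP[_ iA]; have [_ ->] := BP i.
      by rewrite indicE mem_set//; exact: wB.
    have [i iA iB] : exists2 i, i \in A & ~ B i (Y i w).
      by apply: contra_notP wB => H i iA; apply: contra_notP H => ?; exists i.
    rewrite (big_fsetD1 i)//=; have [_ ->] := BP i.
    by rewrite indicE memNset// mul0r.
  rewrite indepY; last by move=> i; case: (BP i).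
  by apply: eq_bigr => i _; have [mB ->] := BP i; rewrite integral_ind.
pose f' B i : R -> R := if i == j then \1_B else f i.
have IHB B : measurable B ->
    (\int[P]_w (\prod_(i <- A) f' B i (Y i w))%R%:E =
     \prod_(i <- A) \int[P]_w (f' B i (Y i w))%:E)%E.
  move=> mB; apply: IH; rewrite /f'.
  - by move=> i; case: ifP => // _; apply: measurable_indic.
  - by move=> i u; case: ifP.
  - by move=> i; case: ifP => // _; exact: fin_ind.
  - move=> i iJ; case: ifPn => ij; first by exists B.
    by apply: indf; rewrite inE negb_or ij.
have [jA|jA] := boolP (j \in A); last first.
  transitivity (\int[P]_w (\prod_(i <- A) (f' setT i (Y i w)))%R%:E)%E.
    apply: eq_integral => w _; congr EFin; apply: eq_big_seq => i iA.
    by rewrite /f' ifN//; apply: contraNneq jA => <-.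
  rewrite IHB//; apply: eq_big_seq => i iA.
  by rewrite /f' ifN//; apply: contraNneq jA => <-.
pose g w := \prod_(i <- (A `\ j)%fset) f i (Y i w).
have prodB B w : \prod_(i <- A) f' B i (Y i w) = g w * \1_B (Y j w).
  rewrite (big_fsetD1 j)//= mulrC /f' eqxx; congr *%R; rewrite /g.
  apply: eq_big_seq => i; rewrite in_fsetD1 => /andP[ij _].
  by rewrite (negbTE ij).
have IHg B : measurable B ->
   (\int[P]_w (g w * \1_B (Y j w))%:E =
    P (Y j @^-1` B) * \prod_(i <- (A `\ j)%fset) \int[P]_w (f i (Y i w))%:E)%E.
  move=> mB; under eq_integral do rewrite -prodB.
  rewrite IHB// (big_fsetD1 j)//= /f' eqxx integral_ind//; congr (_ * _)%E.
  apply: eq_big_seq => i; rewrite in_fsetD1 => /andP[ij _].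
  by rewrite (negbTE ij).
have Ig : (\int[P]_w (g w)%:E =
  \prod_(i <- (A `\ j)%fset) \int[P]_w (f i (Y i w))%:E)%E.
  have := IHg setT measurableT;
    rewrite preimage_setT probability_setT mul1e => <-.
  by apply: eq_integral => w _; rewrite indicT mulr1.
transitivity (\int[P]_w (g w * f j (Y j w))%:E)%E.
  by apply: eq_integral => w _; rewrite (big_fsetD1 j)//= mulrC.
rewrite (ge0_integral_indep (Z := Y j) (f := f j))//.
- by rewrite (big_fsetD1 j)//= muleC Ig.
- apply: measurable_prod => i _.
  by apply: measurableT_comp.
- by move=> w; apply: prodr_ge0.
- by rewrite Ig prode_fin_num.
- by move=> B mB; rewrite IHg// Ig muleC.
Qed.

(** Same scheme as [ge0_integral_prod]: one factor at a time is allowed to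
    change sign, and is split into its positive and negative parts. *)
Lemma expectation_prod (A : {fset I}) (f : I -> R -> R) :
  (forall i, measurable_fun setT (f i)) ->
  (forall i, P.-integrable setT (fun w => (f i (Y i w))%:E)) ->
  P.-integrable setT (fun w => (\prod_(i <- A) f i (Y i w))%:E) /\
  \int[P]_w (\prod_(i <- A) f i (Y i w)) =
  \prod_(i <- A) \int[P]_w f i (Y i w).
Proof.
move=> mf intf.
suff {f mf intf} indJ (J : seq I) (f : I -> R -> R) :
    (forall i, measurable_fun setT (f i)) ->
    (forall i, P.-integrable setT (fun w => (f i (Y i w))%:E)) ->
    (forall i, i \notin J -> forall u, 0 <= f i u) ->
    P.-integrable setT (fun w => (\prod_(i <- A) f i (Y i w))%:E) /\
    \int[P]_w (\prod_(i <- A) f i (Y i w)) =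
    \prod_(i <- A) \int[P]_w f i (Y i w).
  pose f' i : R -> R := if i \in A then f i else cst 0.
  have [] := indJ A f'.
  - by rewrite /f' => i; case: ifP.
  - by rewrite /f' => i; case: ifP => // _; exact: integrable0.
  - by rewrite /f' => i /negbTE ->.
  have -> : (fun w => \prod_(i <- A) f' i (Y i w)) =
            (fun w => \prod_(i <- A) f i (Y i w)).
    by apply/funext => w; apply: eq_big_seq => i iA; rewrite /f' iA.
  move=> H1 H2; split.
    rewrite (_ : (fun w => (\prod_(i <- A) f i (Y i w))%:E) =
            (fun w => (\prod_(i <- A) f' i (Y i w))%:E))//.
    by apply/funext => w; congr EFin; apply: eq_big_seq => i iA; rewrite /f' iA.
  by rewrite H2; apply: eq_big_seq => i iA; rewrite /f' iA.
elim: J f => [|j J IH] f mf intf f0.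
  have mprod : measurable_fun setT (fun w => \prod_(i <- A) f i (Y i w)).
    by apply: measurable_prod => i _; exact: measurableT_comp.
  have fprod w : 0 <= \prod_(i <- A) f i (Y i w).
    by apply: prodr_ge0 => i _; exact: f0.
  have intE : (\int[P]_w (\prod_(i <- A) f i (Y i w))%R%:E =
      (\prod_(i <- A) \int[P]_w f i (Y i w))%R%:E)%E.
    rewrite ge0_integral_prod//; last 2 first.
    - by move=> i u; exact: f0.
    - by move=> i; exact: integrable_fin_num.
    rewrite -prodEFin; apply: eq_bigr => i _.
    by rewrite /Rintegral fineK//; exact: integrable_fin_num.
  split; last by rewrite {1}/Rintegral intE.
  apply/integrableP; split; first exact/measurable_EFinP.
  under eq_integral do rewrite gee0_abs ?lee_fin//.
  by rewrite intE ltry.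
pose fp (b : bool) i : R -> R :=
  if i == j then (if b then (f j)^\+ else (f j)^\-) else f i.
have [IHp IHpE] :
    P.-integrable setT (fun w => (\prod_(i <- A) fp true i (Y i w))%:E) /\
    \int[P]_w (\prod_(i <- A) fp true i (Y i w)) =
    \prod_(i <- A) \int[P]_w fp true i (Y i w).
  apply: IH; rewrite /fp => i.
  - by case: ifP => // _; exact: measurable_funrpos.
  - by case: ifPn => // /eqP->;
    exact: (integrable_funrpos measurableT (intf j)).
  - move=> iJ u; case: ifPn => [_|ij]; first exact: funrpos_ge0.
    by apply: f0; rewrite inE negb_or ij.
have [IHn IHnE] :
    P.-integrable setT (fun w => (\prod_(i <- A) fp false i (Y i w))%:E) /\
    \int[P]_w (\prod_(i <- A) fp false i (Y i w)) =
    \prod_(i <- A) \int[P]_w fp false i (Y i w).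
  apply: IH; rewrite /fp => i.
  - by case: ifP => // _; exact: measurable_funrneg.
  - by case: ifPn => // /eqP->;
    exact: (integrable_funrneg measurableT (intf j)).
  - move=> iJ u; case: ifPn => [_|ij]; first exact: funrneg_ge0.
    by apply: f0; rewrite inE negb_or ij.
have [jA|jA] := boolP (j \in A); last first.
  have fpE b w : \prod_(i <- A) fp b i (Y i w) = \prod_(i <- A) f i (Y i w).
    apply: eq_big_seq => i iA.
    by rewrite /fp ifN//; apply: contraNneq jA => <-.
  split.
    by under eq_fun do rewrite -(fpE true).
  under eq_Rintegral do rewrite -(fpE true).
  rewrite IHpE; apply: eq_big_seq => i iA.
  by rewrite /fp ifN//; apply: contraNneq jA => <-.
have fjE u : f j u = (f j)^\+ u - (f j)^\- u by rewrite -{1}(funrposBneg (f j)).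
have fpE w : \prod_(i <- A) f i (Y i w) =
    \prod_(i <- A) fp true i (Y i w) - \prod_(i <- A) fp false i (Y i w).
  rewrite !(big_fsetD1 j jA)/= /fp eqxx.
  rewrite {1}fjE.
  rewrite mulrBl; congr (_ * _ - _ * _); apply: eq_big_seq => i;
    by rewrite in_fsetD1 => /andP[/negbTE-> _].
split.
  under eq_fun do rewrite fpE EFinB.
  exact: integrableB.
under eq_Rintegral do rewrite fpE.
rewrite RintegralB// IHpE IHnE.
rewrite !(big_fsetD1 j jA)/= /fp eqxx.
have -> : \int[P]_w f j (Y j w) =
  \int[P]_w (f j)^\+ (Y j w) - \int[P]_w (f j)^\- (Y j w).
  rewrite -RintegralB//.
  - by apply: eq_Rintegral => w _; exact: fjE.
  - exact: (integrable_funrpos measurableT (intf j)).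
  - exact: (integrable_funrneg measurableT (intf j)).
rewrite mulrBl; congr (_ * _ - _ * _); apply: eq_big_seq => i;
  by rewrite in_fsetD1 => /andP[/negbTE-> _].
Qed.

End Independence.

(** * Real-valued probabilities *)
Section RealProbability.
Context {R : realType} {d : measure_display} {Omega : measurableType d}
  {P : probability Omega R}.
Local Notation pr E := (fine (P E)).
Implicit Types (E F : set Omega).

Lemma fine_prK E : measurable E -> (pr E)%:E = P E.
Proof. by move=> mE; rewrite fineK// fin_num_measure. Qed.

Lemma le_pr E F : measurable E -> measurable F -> E `<=` F -> pr E <= pr F.
Proof.
by move=> mE mF EF; rewrite -lee_fin !fine_prK//; apply: le_measure;
  rewrite ?inE.
Qed.

Lemma pr_setU_le E F : measurable E -> measurable F ->
  pr (E `|` F) <= pr E + pr F.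
Proof.
move=> mE mF; rewrite -lee_fin EFinD !fine_prK//; last exact: measurableU.
exact: measureU2.
Qed.

Lemma pr_setU E F : measurable E -> measurable F ->
  pr (E `|` F) = pr E + pr F - pr (E `&` F).
Proof.
move=> mE mF; apply: EFin_inj; rewrite EFinB EFinD !fine_prK//; last first.
- exact: measurableU.
- exact: measurableI.
by apply: measureUfinl => //; rewrite -ge0_fin_numE// fin_num_measure.
Qed.

Lemma pr_le_Rintegral E (f : Omega -> R) : measurable E ->
  P.-integrable setT (EFin \o f) -> (forall w, \1_E w <= f w) ->
  pr E <= \int[P]_w f w.
Proof.
move=> mE intf Ef.
have -> : pr E = \int[P]_w \1_E w.
  by rewrite /Rintegral integral_indic// setIT.
by apply: le_Rintegral => //; exact: integrable_indic.
Qed.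

Lemma integrable_bigsum (I : Type) (s : seq I) (h : I -> Omega -> R) :
  (forall i, P.-integrable setT (fun w => (h i w)%:E)) ->
  P.-integrable setT (fun w => (\sum_(i <- s) h i w)%:E).
Proof.
move=> inth; under eq_fun do rewrite -sumEFin.
exact: integrable_sum.
Qed.

Lemma Rintegral_bigsum (I : Type) (s : seq I) (h : I -> Omega -> R) :
  (forall i, P.-integrable setT (fun w => (h i w)%:E)) ->
  \int[P]_w (\sum_(i <- s) h i w) = \sum_(i <- s) \int[P]_w h i w.
Proof.
move=> inth; elim: s => [|i s IH].
  by under eq_Rintegral do rewrite big_nil;
    rewrite Rintegral_cst// mul0r big_nil.
under eq_Rintegral do rewrite big_cons.
rewrite RintegralD//; [by rewrite big_cons IH|exact: inth|].
exact: integrable_bigsum.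
Qed.

Lemma measurable_superlevel (f : Omega -> R) y : measurable_fun setT f ->
  measurable [set w | y <= f w].
Proof.
move=> mf; have -> : [set w | y <= f w] = f @^-1` `[y, +oo[%classic.
  by apply/seteqP; split => w /=; rewrite in_itv/= andbT.
by rewrite -[X in measurable X]setTI; apply: mf.
Qed.

End RealProbability.

Lemma pr_second_moment {R : realType} {d : measure_display}
  {Omega : measurableType d}
  {P : probability Omega R} (f : Omega -> R) (tau e : R) :
  measurable_fun setT f -> 0 < tau ->
  (\int[P]_w (f w ^+ 2)%:E <= e%:E)%E ->
  fine (P [set w | tau <= `|f w|]) <= e / tau ^+ 2.
Proof.
move=> mf tau0 le_e.
have mf2 : measurable_fun setT (fun w => f w ^+ 2) by exact: measurable_funX.
have int2 : P.-integrable setT (fun w => (f w ^+ 2)%:E).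
  apply/integrableP; split; first exact/measurable_EFinP.
  under eq_integral do rewrite gee0_abs ?lee_fin ?sqr_ge0//.
  exact: le_lt_trans le_e (ltry _).
have le_e' : \int[P]_w (f w ^+ 2) <= e.
  by rewrite -lee_fin /Rintegral fineK//; exact: integrable_fin_num.
apply: (@le_trans _ _ (\int[P]_w (tau ^- 2 * f w ^+ 2))).
  apply: pr_le_Rintegral.
  - by apply: measurable_superlevel; exact: measurableT_comp.
  - by rewrite /comp; under eq_fun do rewrite EFinM; exact: integrableZl.
  move=> w; rewrite indicE; case: (boolP (w \in _)); rewrite ?inE; last first.
    by move=> _; rewrite mulr_ge0 ?invr_ge0 ?sqr_ge0.
  move=> /= le_tau.
  rewrite ler_pdivlMl ?exprn_gt0// mulr1 -[leRHS]real_normK ?num_real//.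
  by rewrite ler_pXn2r// nnegrE ltW.
by rewrite RintegralZl// mulrC ler_wpM2r// invr_ge0 sqr_ge0.
Qed.

(** * Second moments on an event *)
Section Moments.
Context {R : realType} {d : measure_display} {Omega : measurableType d}
  {P : probability Omega R} {I : choiceType} {Y : I -> {RV P >-> R}}.
Local Notation pr E := (fine (P E)).
Hypothesis indepY : mutually_independent Y.
Hypothesis intY : forall i, P.-integrable setT (fun w => (Y i w)%:E).
Hypothesis intY2 : forall i, P.-integrable setT (fun w => (Y i w ^+ 2)%:E).
Hypothesis meanY : forall i, \int[P]_w Y i w = 0.
Hypothesis varY : forall i, \int[P]_w (Y i w ^+ 2) = 1.
Variable c : I -> R.

Lemma pr_preimage (i : I) (B : set R) : measurable B ->
  \int[P]_w \1_B (Y i w) = pr (Y i @^-1` B).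
Proof.
move=> mB; rewrite /Rintegral
  -[X in fine X]/(\int[P]_w (\1_(Y i @^-1` B) w)%:E)%E.
by rewrite integral_indic// ?setIT// -[X in measurable X]setTI;
  exact: measurable_funP.
Qed.

Lemma measurable_lincomb (A : {fset I}) :
  measurable_fun setT (fun w => \sum_(s <- A) c s * Y s w).
Proof.
by apply: measurable_sum => s; exact: measurable_funM.
Qed.

Lemma cross_moment (r s u : I) (B : set R) : measurable B -> s != r -> u != r ->
  P.-integrable setT (fun w => (\1_B (Y r w) * (Y s w * Y u w))%:E) /\
  \int[P]_w (\1_B (Y r w) * (Y s w * Y u w)) =
  if s == u then pr (Y r @^-1` B) else 0.
Proof.
move=> mB sr ur.
have mYB i : measurable (Y i @^-1` B).
  by rewrite -[X in measurable X]setTI; exact: measurable_funP.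
have intB i : P.-integrable setT (fun w => (\1_B (Y i w))%:E).
  rewrite -[F in _.-integrable _ F]/(fun w => (\1_(Y i @^-1` B) w)%:E).
  exact: integrable_indic.
case: ifPn => [/eqP <-{u ur}|su].
- pose f i : R -> R := if i == r then \1_B else fun u => u ^+ 2.
  have fE w : \1_B (Y r w) * (Y s w * Y s w) =
              \prod_(i <- (r |` [fset s])%fset) f i (Y i w).
    rewrite big_fsetU1/= ?inE 1?eq_sym// big_seq_fset1.
    by rewrite /f eqxx (negbTE sr) expr2.
  have [] := @expectation_prod _ _ _ _ _ _ indepY (r |` [fset s])%fset f.
  - by move=> i; rewrite /f; case: ifP => // _; apply: measurable_indic.
  - by move=> i; rewrite /f; case: ifP.
  move=> intf If; split; first by under eq_fun do rewrite fE.
  under eq_Rintegral do rewrite fE.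
  rewrite If big_fsetU1/= ?inE 1?eq_sym// big_seq_fset1.
  by rewrite /f eqxx (negbTE sr) pr_preimage// varY mulr1.
- pose f i : R -> R := if i == r then \1_B else idfun.
  have rsu : r \notin (s |` [fset u])%fset by rewrite !inE negb_or
    ![r == _]eq_sym sr.
  have su' : s \notin [fset u]%fset by rewrite inE.
  have fE w : \1_B (Y r w) * (Y s w * Y u w) =
              \prod_(i <- (r |` (s |` [fset u]))%fset) f i (Y i w).
    rewrite !big_fsetU1//= big_seq_fset1.
    by rewrite /f eqxx (negbTE sr) (negbTE ur).
  have [] := @expectation_prod _ _ _ _ _ _ indepY (r |` (s |` [fset u]))%fset f.
  - by move=> i; rewrite /f; case: ifP => _;
    [exact: measurable_indic|exact: measurable_id].
  - by move=> i; rewrite /f; case: ifP => _; [exact: intB|exact: intY].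
  move=> intf If; split; first by under eq_fun do rewrite fE.
  under eq_Rintegral do rewrite fE.
  rewrite If !big_fsetU1//= big_seq_fset1.
  by rewrite /f eqxx (negbTE sr) (negbTE ur) !meanY !mulr0.
Qed.

(** The orthogonality of the [Y s] survives the restriction to an event about
    another variable [Y r].  This replaces the independence of [Y r] and of the
    whole sum of the other variables. *)
Lemma second_moment (r : I) (A : {fset I}) (B : set R) :
  measurable B -> r \notin A ->
  P.-integrable setT (fun w =>
    (\1_B (Y r w) * (\sum_(s <- A) c s * Y s w) ^+ 2)%:E) /\
  \int[P]_w (\1_B (Y r w) * (\sum_(s <- A) c s * Y s w) ^+ 2) =
  pr (Y r @^-1` B) * \sum_(s <- A) c s ^+ 2.
Proof.
move=> mB rA.
pose g s u w := if (s \in A) &&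
  (u \in A) then c s * c u * (\1_B (Y r w) * (Y s w * Y u w)) else 0.
have sqE w : \1_B (Y r w) * (\sum_(s <- A) c s * Y s w) ^+ 2 =
    \sum_(s <- A) \sum_(u <- A) g s u w.
  rewrite expr2 big_distrlr/= mulr_sumr; apply: eq_big_seq => s sA.
  rewrite mulr_sumr; apply: eq_big_seq => u uA; rewrite /g sA uA/=.
  by ring.
have rneq s : s \in A -> s != r by apply: contraTneq => ->.
have intg s u : P.-integrable setT (fun w => (g s u w)%:E).
  rewrite /g; case: (boolP (_ && _)) => [/andP[sA uA]|_];
    last exact: integrable0.
  under eq_fun do rewrite EFinM.
  by apply: integrableZl => //;
    apply: (cross_moment mB (rneq _ sA) (rneq _ uA)).1.
have Ig s u : s \in A -> u \in A -> \int[P]_w g s u w =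
    if s == u then c s ^+ 2 * pr (Y r @^-1` B) else 0.
  move=> sA uA; rewrite /g sA uA/= RintegralZl//; last first.
    by apply: (cross_moment mB (rneq _ sA) (rneq _ uA)).1.
  rewrite (cross_moment mB (rneq _ sA) (rneq _ uA)).2.
  by case: eqP => [->|_]; rewrite ?mulr0// expr2.
split.
  under eq_fun do rewrite sqE.
  by apply: integrable_bigsum => s; exact: integrable_bigsum.
under eq_Rintegral do rewrite sqE.
rewrite Rintegral_bigsum; last by move=> s; exact: integrable_bigsum.
rewrite mulr_sumr; apply: eq_big_seq => s sA.
rewrite Rintegral_bigsum// (big_fsetD1 s sA)/= Ig// eqxx mulrC.
rewrite big1_seq ?addr0// => u /andP[_]; rewrite in_fsetD1 => /andP[us uA].
by rewrite Ig// eq_sym (negbTE us).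
Qed.

Lemma chebyshev_rest (r : I) (A : {fset I}) (B : set R) (tau : R) :
  measurable B -> r \notin A -> 0 < tau ->
  pr ((Y r @^-1` B) `&` [set w | tau <= `|\sum_(s <- A) c s * Y s w|]) <=
  pr (Y r @^-1` B) * (\sum_(s <- A) c s ^+ 2) / tau ^+ 2.
Proof.
move=> mB rA tau0.
have [int2 E2] := second_moment mB rA.
rewrite -E2 mulrC -RintegralZl//.
have mYB : measurable (Y r @^-1` B).
  by rewrite -[X in measurable X]setTI; exact: measurable_funP.
apply: pr_le_Rintegral => //.
- apply: measurableI => //; apply: measurable_superlevel.
  by apply: measurableT_comp => //; exact: measurable_lincomb.
- by rewrite /comp; under eq_fun do rewrite EFinM; exact: integrableZl.
move=> w; rewrite indicE; case: (boolP (w \in _)); rewrite ?inE; last first.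
  by move=> _; rewrite mulr_ge0 ?invr_ge0 ?sqr_ge0// mulr_ge0// sqr_ge0.
move=> -[wB /= le_tau]; rewrite indicE mem_set// mul1r.
rewrite ler_pdivlMl ?exprn_gt0// mulr1 -[leRHS]real_normK ?num_real//.
by rewrite ler_pXn2r// nnegrE ltW.
Qed.

End Moments.

(** * Union bound and Bonferroni's inequality *)
Section Unions.
Context {R : realType} {d : measure_display} {Omega : measurableType d}
  {P : probability Omega R} {I : choiceType}.
Local Notation pr E := (fine (P E)).

Lemma exists_cons (r : I) (s : seq I) (E : I -> set Omega) :
  [set w | exists2 i, i \in r :: s & E i w] =
  E r `|` [set w | exists2 i, i \in s & E i w].
Proof.
apply/seteqP; split => w /= => [[i]|[Ew|[i si Ew]]].
- by rewrite inE => /orP[/eqP->|si] Ew; [left|right; exists i].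
- by exists r; rewrite ?mem_head.
- by exists i; rewrite // inE si orbT.
Qed.

Lemma exists_nil (E : I -> set Omega) :
  [set w | exists2 i, i \in [::] & E i w] = set0.
Proof. by apply/seteqP; split => w //= -[]. Qed.

Lemma measurable_exists (s : seq I) (E : I -> set Omega) :
  (forall i, measurable (E i)) ->
  measurable [set w | exists2 i, i \in s & E i w].
Proof.
move=> mE; elim: s => [|r s IH]; first by rewrite exists_nil.
by rewrite exists_cons; exact: measurableU.
Qed.

Lemma pr_exists_le (s : seq I) (E : I -> set Omega) :
  (forall i, measurable (E i)) ->
  pr [set w | exists2 i, i \in s & E i w] <= \sum_(i <- s) pr (E i).
Proof.
move=> mE; elim: s => [|r s IH].
  by rewrite exists_nil measure0 big_nil.
rewrite exists_cons big_cons.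
apply: le_trans (pr_setU_le _ _) _ => //; first exact: measurable_exists.
by rewrite lerD2l.
Qed.

Lemma bonferroni (s : seq I) (E : I -> set Omega) (p : I -> R) :
  (forall i, measurable (E i)) -> (forall i, 0 <= p i) -> uniq s ->
  (forall i j, i != j -> pr (E i `&` E j) <= p i * p j) ->
  \sum_(i <- s) pr (E i) - (\sum_(i <- s) p i) ^+ 2 <=
  pr [set w | exists2 i, i \in s & E i w].
Proof.
move=> mE p0 + pE; elim: s => [_|r s IH].
  by rewrite exists_nil measure0 !big_nil expr0n subr0.
move=> /=/andP[rs us]; rewrite exists_cons !big_cons.
rewrite pr_setU//; last exact: measurable_exists.
have cap : pr (E r `&` [set w | exists2 i, i \in s & E i w]) <=
    p r * \sum_(i <- s) p i.
  have -> : E r `&` [set w | exists2 i, i \in s & E i w] =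
     [set w | exists2 i, i \in s & (E r `&` E i) w].
    apply/seteqP; split => [w [Er [i si Ei]]|w [i si [Er Ei]]].
      by exists i.
    by split => //; exists i.
  apply: le_trans (pr_exists_le _ _) _; first by move=> i; exact: measurableI.
  rewrite mulr_sumr big_seq [leRHS]big_seq; apply: ler_sum => i si.
  by apply: pE; apply: contraNneq rs => ->.
have := IH us.
have Q0 : 0 <= \sum_(i <- s) p i by exact: sumr_ge0.
have := p0 r.
set Q := \sum_(i <- s) p i in Q0 cap *; set p' := p r in cap *.
move: cap; set x1 := pr _; set x2 := pr _; set x3 := \sum_(_ <- _) _;
  set x4 := pr _.
nra.
Qed.

End Unions.

(** * Large deviations of finite sums *)

(** Inverting [1 - v <= expR (- v)]; negative [v] need no truncation, which is
    why the left tail of the innovations is irrelevant. *)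
Lemma expR_le_quadratic {R : realType} (v : R) : v <= 2^-1 ->
  expR v <= 1 + v + 2 * v ^+ 2.
Proof.
move=> v2; have v1 : 0 < 1 - v by lra.
rewrite -[v in expR v]opprK expRN -[leLHS]div1r ler_pdivrMr ?expR_gt0//.
have := expR_ge1Dx (- v); have : 0 <= v ^+ 2 * (1 - 2 * v).
  by rewrite mulr_ge0 ?sqr_ge0//; lra.
have : 0 <= 1 + v + 2 * v ^+ 2 by nra.
nra.
Qed.

Section JumpsOfFiniteSums.
Context {R : realType} {d : measure_display} {Omega : measurableType d}
  {P : probability Omega R} {I : choiceType} {Y : I -> {RV P >-> R}}.
Local Notation pr E := (fine (P E)).
Hypothesis indepY : mutually_independent Y.
Hypothesis intY : forall i, P.-integrable setT (fun w => (Y i w)%:E).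
Hypothesis intY2 : forall i, P.-integrable setT (fun w => (Y i w ^+ 2)%:E).
Hypothesis meanY : forall i, \int[P]_w Y i w = 0.
Hypothesis varY : forall i, \int[P]_w (Y i w ^+ 2) = 1.
Variables (c : I -> R) (G : R -> R) (A : {fset I}).
Hypothesis c_gt0 : forall i, 0 < c i.
Hypothesis G_tail : forall i u, pr [set w | u <= Y i w] = G u.
Hypothesis G_ge0 : forall u, 0 <= G u.
Hypothesis c_sq : \sum_(i <- A) c i ^+ 2 <= 1.

Let S w := \sum_(i <- A) c i * Y i w.

Lemma pr_jump i y : pr [set w | y <= c i * Y i w] = G (y / c i).
Proof.
rewrite -(G_tail i); congr (fine (P _)); apply/seteqP.
by split => w /=; rewrite ler_pdivrMr// mulrC.
Qed.

Lemma measurable_jump i y : measurable [set w | y <= c i * Y i w].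
Proof. by apply: measurable_superlevel; exact: measurable_funM. Qed.

(** A jump of one summand does not help the rest of the sum, whose variance is
    at most 1. *)
Lemma pr_jump_and_rest i y delta u : i \in A -> 0 < y -> 0 < delta ->
  pr ([set w | u <= c i * Y i w] `&`
    [set w | delta * y <= `|\sum_(j <- (A `\ i)%fset) c j * Y j w|]) <=
  G (u / c i) / (delta * y) ^+ 2.
Proof.
move=> iA y0 d0; have dy0 : 0 < delta * y by exact: mulr_gt0.
have -> : [set w | u <= c i * Y i w] = Y i @^-1` [set v | u / c i <= v].
  by apply/seteqP; split => w /=; rewrite ler_pdivrMr// [Y i w * _]mulrC.
apply: le_trans (chebyshev_rest indepY intY intY2 meanY varY c _ _ dy0) _.
- by apply: measurable_superlevel; exact: measurable_id.
- by rewrite !inE eqxx.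
have -> : pr (Y i @^-1` [set v | u / c i <= v]) = G (u / c i) by exact: G_tail.
rewrite -mulrA ler_wpM2l//.
rewrite ler_pdivrMr ?exprn_gt0// mulVf ?gt_eqF ?exprn_gt0//.
by apply: le_trans c_sq; rewrite (big_fsetD1 i iA)/= lerDr sqr_ge0.
Qed.

Lemma pr_two_jumps i j u v : i != j ->
  pr ([set w | u <= c i * Y i w] `&` [set w | v <= c j * Y j w]) =
  G (u / c i) * G (v / c j).
Proof.
move=> ij.
pose B k : set R := if k == i then [set x | u / c i <= x] else
  [set x | v / c j <= x].
have mB k : measurable (B k).
  by rewrite /B; case: ifP => _; apply: measurable_superlevel;
    exact: measurable_id.
have := indepY [fset i; j]%fset mB.
have -> : \bigcap_(k in [set` [fset i; j]%fset]) (Y k @^-1` B k) =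
    [set w | u <= c i * Y i w] `&` [set w | v <= c j * Y j w].
  apply/seteqP; split => w /=.
    move=> H; have := H i; rewrite /B /= !inE eqxx /= => /(_ isT).
    have := H j; rewrite /B /= !inE eqxx orbT eq_sym (negbTE ij) /= => /(_ isT).
    by rewrite !ler_pdivrMr// ![Y _ w * _]mulrC.
  move=> [H1 H2] k /=; rewrite !inE => /orP[]/eqP->; rewrite /B.
    by rewrite eqxx/= ler_pdivrMr// mulrC.
  by rewrite eq_sym (negbTE ij)/= ler_pdivrMr// mulrC.
move=> ->; rewrite big_fsetU1/= ?inE// big_seq_fset1 /B eqxx eq_sym (negbTE ij).
rewrite fineM; [by congr (_ * _); exact: G_tail|..];
  by apply: fin_num_measure; apply: measurable_superlevel.
Qed.

(** A jump of size [eps y] that stays below [(1 - delta) y] needs the rest of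
    the sum to exceed [delta y]. *)
Lemma pr_sum_ge_split (y delta eps : R) : 0 < y -> 0 < delta ->
  pr [set w | y <= S w] <=
    \sum_(i <- A) G ((1 - delta) * y / c i) +
    (\sum_(i <- A) G (eps * y / c i)) / (delta * y) ^+ 2 +
    pr ([set w | y <= S w] `\`
        [set w | exists2 i, i \in A & eps * y <= c i * Y i w]).
Proof.
move=> y0 d0.
have dy0 : 0 < delta * y by exact: mulr_gt0.
pose E1 i := [set w | (1 - delta) * y <= c i * Y i w].
pose E2 i := [set w | eps * y <= c i * Y i w] `&`
   [set w | delta * y <= `|\sum_(j <- (A `\ i)%fset) c j * Y j w|].
pose E3 i := [set w | eps * y <= c i * Y i w].
have mE1 i : measurable (E1 i) by exact: measurable_jump.
have mE3 i : measurable (E3 i) by exact: measurable_jump.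
have mE2 i : measurable (E2 i).
  apply: measurableI; first exact: mE3.
  apply: measurable_superlevel.
  by apply: measurableT_comp => //; exact: measurable_lincomb.
have mS : measurable [set w | y <= S w].
  by apply: measurable_superlevel; exact: measurable_lincomb.
have mX1 := measurable_exists (enum_fset A) mE1.
have mX2 := measurable_exists (enum_fset A) mE2.
have mX3 := measurable_exists (enum_fset A) mE3.
apply: (@le_trans _ _ (pr (([set w | exists2 i, i \in A & E1 i w] `|`
   [set w | exists2 i, i \in A & E2 i w]) `|`
   ([set w | y <= S w] `\` [set w | exists2 i, i \in A & E3 i w])))).
  apply: le_pr => //.
    by apply: measurableU; [exact: measurableU|exact: measurableD].
  move=> w /= yS.
  have [[i iA E3i]|nE3] := pselect (exists2 i, i \in A & E3 i w); last by right.
  left; have [le1|lt1] := leP ((1 - delta) * y) (c i * Y i w); first by left;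
    exists i.
  right; exists i => //; split => //=.
  apply: le_trans (ler_norm _).
  by move: yS; rewrite /S (big_fsetD1 i iA)/=; lra.
apply: le_trans (pr_setU_le _ _) _; [exact: measurableU|exact: measurableD|].
rewrite lerD2r; apply: le_trans (pr_setU_le _ _) _ => //; apply: lerD.
  apply: le_trans (pr_exists_le _ mE1) _.
  by apply: ler_sum => i _; rewrite pr_jump.
apply: le_trans (pr_exists_le _ mE2) _; rewrite mulr_suml.
rewrite big_seq [leRHS]big_seq; apply: ler_sum => i iA.
exact: pr_jump_and_rest.
Qed.

(** The subtracted square bounds the overlaps of the events that one given
    summand is large and the rest small. *)
Lemma pr_sum_ge_lower (y delta : R) : 0 < y -> 0 < delta ->
  (\sum_(i <- A) G ((1 + delta) * y / c i)) * (1 - (delta * y) ^- 2) -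
    (\sum_(i <- A) G ((1 + delta) * y / c i)) ^+ 2 <=
  pr [set w | y <= S w].
Proof.
move=> y0 d0.
have dy0 : 0 < delta * y by exact: mulr_gt0.
pose E1 i := [set w | (1 + delta) * y <= c i * Y i w].
pose E2 i := [set w | delta * y <= `|\sum_(j <- (A `\ i)%fset) c j * Y j w|].
have mE1 i : measurable (E1 i) by exact: measurable_jump.
have mE2 i : measurable (E2 i).
  apply: measurable_superlevel.
  by apply: measurableT_comp => //; exact: measurable_lincomb.
have mS : measurable [set w | y <= S w].
  by apply: measurable_superlevel; exact: measurable_lincomb.
pose E i := E1 i `\` E2 i.
have mE i : measurable (E i) by exact: measurableD.
have mX := measurable_exists (enum_fset A) mE.
apply: (@le_trans _ _ (pr [set w | exists2 i, i \in A & E i w])); last first.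
  apply: le_pr => // w [i iA [/= le1 /negP]]; rewrite -ltNge => lt2.
  move: le1 lt2; rewrite /S (big_fsetD1 i iA)/= ltr_norml => le1 /andP[+ _].
  by move: le1; rewrite /E1 /=; lra.
apply: le_trans (bonferroni (p := fun i => G ((1 + delta) * y / c i)) mE _ _ _).
- rewrite mulr_suml lerD2r big_seq [leRHS]big_seq; apply: ler_sum => i iA.
  have EE : pr (E1 i) = pr (E i) + pr (E1 i `&` E2 i).
    by apply: EFin_inj; rewrite EFinD !fine_prK//;
      [exact: measureDI|exact: measurableI].
  have := pr_jump_and_rest ((1 + delta) * y) iA y0 d0;
    rewrite -/(E1 i) -/(E2 i) mulrBr mulr1.
  have := pr_jump i ((1 + delta) * y); rewrite -/(E1 i) EE.
  by set x1 := _ / _ ^+ 2; lra.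
- by [].
- exact: fset_uniq.
- move=> i j ij; rewrite -pr_two_jumps//; apply: le_pr.
  + exact: measurableI.
  + by apply: measurableI; exact: mE1.
  + by move=> w [[H1 _] [H2 _]].
Qed.

(** Chernoff's method.  The exponential of a truncated summand [lambda c Y] is
    bounded by its quadratic expansion where [lambda c Y <= 1/2], and by its
    maximum [expR (lambda eps y)] on the rare event where it is larger. *)
Lemma pr_sum_no_big_jump (y lambda eps : R) : 0 < lambda ->
  pr ([set w | y <= S w] `\`
      [set w | exists2 i, i \in A & eps * y <= c i * Y i w]) <=
  expR (- (lambda * y) + 2 * lambda ^+ 2 +
    expR (lambda * (eps * y)) * \sum_(i <- A) G ((2 * lambda)^-1 / c i)).
Proof.
move=> l0.
pose f i : R -> R := fun u => expR (lambda * c i * u) * \1_(`]-oo,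
  eps * y / c i[%classic) u.
have mf i : measurable_fun setT (f i).
  apply: measurable_funM; last by apply: measurable_indic.
  by apply: measurableT_comp => //; exact: measurable_funM.
have f0 i u : 0 <= f i u by rewrite mulr_ge0// expR_ge0.
have fle i u : f i u <= expR (lambda * (eps * y)).
  rewrite /f indicE mem_setE/= in_itv/=; case: ltP => [lt1|_]; last first.
    by rewrite mulr0 expR_ge0.
  rewrite mulr1 ler_expR -mulrA ler_pM2l//.
  by move: lt1; rewrite ltr_pdivlMr// mulrC => /ltW.
have intf i : P.-integrable setT (fun w => (f i (Y i w))%:E).
  apply: (@le_integrable _ _ _ _ _ measurableT _
    (cst (expR (lambda * (eps * y)))%:E)).
  - by apply/measurable_EFinP; exact: measurableT_comp.
  - by move=> w _ /=; rewrite !ger0_norm ?lee_fin// expR_ge0.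
  - by apply: finite_measure_integrable_cst.
have Ef i : \int[P]_w f i (Y i w) <= expR (2 * lambda ^+ 2 * c i ^+ 2 +
    expR (lambda * (eps * y)) * G ((2 * lambda)^-1 / c i)).
  set K := expR (lambda * (eps * y)).
  pose T := [set w | (2 * lambda)^-1 <= c i * Y i w].
  have mT : measurable T by exact: measurable_jump.
  pose q w := 1 + (lambda * c i * Y i w +
    (2 * lambda ^+ 2 * c i ^+ 2 * (Y i w) ^+ 2 + K * \1_T w)).
  have int1 : P.-integrable setT (EFin \o (fun w => lambda * c i * Y i w)).
    by rewrite /comp; under eq_fun do rewrite EFinM; exact: integrableZl.
  have int2 : P.-integrable setT
    (EFin \o (fun w => 2 * lambda ^+ 2 * c i ^+ 2 * (Y i w) ^+ 2)).
    by rewrite /comp; under eq_fun do rewrite EFinM; exact: integrableZl.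
  have int3 : P.-integrable setT (EFin \o (fun w => K * \1_T w)).
    rewrite /comp; under eq_fun do rewrite EFinM; apply: integrableZl => //.
    exact: integrable_indic.
  have int23 : P.-integrable setT
    (EFin \o (fun w => 2 * lambda ^+ 2 * c i ^+ 2 * (Y i w) ^+ 2 + K * \1_T w)).
    exact: (integrableD measurableT int2 int3).
  have int123 : P.-integrable setT
    (EFin \o (fun w => lambda * c i * Y i w +
    (2 * lambda ^+ 2 * c i ^+ 2 * (Y i w) ^+ 2 + K * \1_T w))).
    exact: (integrableD measurableT int1 int23).
  have int0 : P.-integrable setT (EFin \o (fun w : Omega => 1 : R)).
    exact: finite_measure_integrable_cst.
  have intq : P.-integrable setT (EFin \o q) by exact:
    (integrableD measurableT int0 int123).
  have Eq : \int[P]_w q w = 1 +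
    (2 * lambda ^+ 2 * c i ^+ 2 + K * G ((2 * lambda)^-1 / c i)).
    rewrite /q RintegralD// Rintegral_cst// RintegralD// RintegralD//.
    have intT : P.-integrable setT (EFin \o (\1_T : Omega -> R)) by exact:
      integrable_indic.
    rewrite (RintegralZl _ measurableT (intY i))
      (RintegralZl _ measurableT (intY2 i)).
    rewrite (RintegralZl _ measurableT intT).
    rewrite meanY varY mulr0 add0r !mulr1 mul1r.
    have -> : \int[P]_w \1_T w =
      pr T by rewrite /Rintegral integral_indic// setIT.
    by rewrite /T pr_jump; congr (_ + _);
      exact: (congr1 fine (probability_setT P)).
  apply: (@le_trans _ _ (\int[P]_w q w)); last by rewrite Eq; exact: expR_ge1Dx.
  apply: (le_Rintegral measurableT (intf i) intq) => w _; rewrite /q.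
  have [le1|lt1] := leP (2 * lambda)^-1 (c i * Y i w).
    rewrite [\1_T w]indicE mem_set// mulr1.
    have v0 : 0 <= lambda * c i * Y i w.
      by rewrite -mulrA mulr_ge0 ?ltW// (lt_le_trans _ le1)// invr_gt0 mulr_gt0.
    have : 0 <= 2 * (lambda * c i * Y i w) ^+ 2 by rewrite mulr_ge0// sqr_ge0.
    rewrite !exprMn !mulrA.
    have := fle i (Y i w); rewrite -/K; lra.
  rewrite [\1_T w]indicE memNset; last by move=> /=; apply/negP; rewrite -ltNge.
  rewrite mulr0 addr0.
  have v2 : lambda * c i * Y i w <= 2^-1.
    rewrite -mulrA; move: (ltW lt1); rewrite invfM ler_pdivlMr//.
    by rewrite mulrC.
  apply: (@le_trans _ _ (expR (lambda * c i * Y i w))).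
    rewrite /f indicE; case: (_ \in _); first by rewrite mulr1.
    by rewrite mulr0 expR_ge0.
  apply: le_trans (expR_le_quadratic v2) _.
  by rewrite !exprMn !mulrA addrA.
have [intprod Eprod] := expectation_prod indepY A mf intf.
apply: (@le_trans _ _ (expR (- (lambda * y)) * \prod_(i <- A) \int[P]_w f i
  (Y i w))).
  rewrite -Eprod -RintegralZl//; apply: pr_le_Rintegral.
  - apply: measurableD; last by apply: measurable_exists => i;
    exact: measurable_jump.
    by apply: measurable_superlevel; exact: measurable_lincomb.
  - by rewrite /comp; under eq_fun do rewrite EFinM; exact: integrableZl.
  move=> w; rewrite indicE; case: (boolP (w \in _)); rewrite ?inE; last first.
    by move=> _; rewrite mulr_ge0 ?expR_ge0// prodr_ge0.
  move=> [/= yS noE].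
  have -> : \prod_(i <- A) f i (Y i w) =
    \prod_(i <- A) expR (lambda * c i * Y i w).
    apply: eq_big_seq => i iA; rewrite /f indicE mem_set ?mulr1//= in_itv/=.
    rewrite ltNge; apply/negP => le1; apply: noE; exists i => //.
    by move: le1; rewrite ler_pdivrMr// [Y i w * _]mulrC.
  rewrite -expR_sum -expRD -[leLHS]expR0 ler_expR.
  under eq_bigr do rewrite -mulrA.
  by rewrite -mulr_sumr addrC subr_ge0 ler_pM2l.
rewrite -addrA expRD ler_pM2l ?expR_gt0//.
apply: (@le_trans _ _ (\prod_(i <- A) expR (2 * lambda ^+ 2 * c i ^+ 2 +
    expR (lambda * (eps * y)) * G ((2 * lambda)^-1 / c i)))).
  apply: ler_prod => i _; rewrite Ef andbT.
  by apply: Rintegral_ge0 => w _.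
rewrite -expR_sum ler_expR big_split/= -!mulr_sumr lerD2r.
by rewrite -[leRHS]mulr1 ler_wpM2l// mulr_ge0// ?sqr_ge0.
Qed.

End JumpsOfFiniteSums.

(** * Regularly varying tails *)
Section RegularVariation.
Context {R : realType}.
Implicit Types (G h phi : R -> R) (t s u : R).

(** Applied to [G u * u `^ s] and to [- (G u * u `^ p)], this turns the
    asymptotic value of [G (2 u) / G u] into power bounds. *)
Lemma doubling_bound phi (u0 M : R) : 0 < u0 ->
  (forall u, u0 <= u -> phi (2 * u) <= phi u) ->
  (forall u, u0 <= u <= 2 * u0 -> phi u <= M) ->
  forall u, u0 <= u -> phi u <= M.
Proof.
move=> u00 dbl base u u0u.
have le_pow n : u <= 2 ^+ n * u0 -> phi u <= M.
  elim: n u u0u => [|n IH] u u0u; rewrite ?expr0 ?exprS => le_n.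
    by apply: base; rewrite u0u/=; lra.
  have [le2|lt2] := leP u (2 * u0); first by apply: base; rewrite u0u.
  have -> : u = 2 * (u / 2) by field.
  have u2 : u0 <= u / 2 by lra.
  apply: le_trans (dbl _ u2) _; apply: IH => //.
  by rewrite ler_pdivrMr// mulrC mulrA.
pose n := Num.truncn (u / u0).
apply: (le_pow n.+1); rewrite -ler_pdivrMr//.
apply: (@le_trans _ _ n.+1%:R); first by rewrite ltW// truncnS_gt.
by rewrite -natrX ler_nat ltnW// ltn_expl.
Qed.

Definition regularly_varying_tail G t :=
  forall lambda, 0 < lambda -> G (lambda * u) / G u @[u --> +oo] -->
    lambda `^ (- t).

Section RegularlyVaryingTail.
Variables (G : R -> R) (t : R).
Hypothesis G_noninc : {homo G : u v / u <= v >-> v <= u}.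
Hypothesis G_gt0 : forall u, 0 < G u.
Hypothesis G_le1 : forall u, G u <= 1.
Hypothesis G_rv : regularly_varying_tail G t.

Lemma tail_dilation_le lambda K : 0 < lambda -> lambda `^ (- t) < K ->
  exists2 u0, 0 < u0 & forall u, u0 <= u -> G (lambda * u) <= K * G u.
Proof.
move=> l0 lK; have : \forall u \near +oo, G (lambda * u) / G u < K.
  exact: (cvgr_lt _ (G_rv l0) _ lK).
move=> [u0 [_ Hu]]; exists (Num.max (u0 + 1) 1);
  first by rewrite lt_max ltr01 orbT.
move=> u; rewrite ge_max => /andP[u1 _].
have : G (lambda * u) / G u < K by apply: Hu; lra.
by rewrite ltr_pdivrMr// => /ltW.
Qed.

Lemma tail_dilation_ge lambda K : 0 < lambda -> K < lambda `^ (- t) ->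
  exists2 u0, 0 < u0 & forall u, u0 <= u -> K * G u <= G (lambda * u).
Proof.
move=> l0 lK; have : \forall u \near +oo, K < G (lambda * u) / G u.
  exact: (cvgr_gt _ (G_rv l0) _ lK).
move=> [u0 [_ Hu]]; exists (Num.max (u0 + 1) 1);
  first by rewrite lt_max ltr01 orbT.
move=> u; rewrite ge_max => /andP[u1 _].
have : K < G (lambda * u) / G u by apply: Hu; lra.
by rewrite ltr_pdivlMr// => /ltW.
Qed.

Lemma powR2_lt (p q : R) : p < q -> 2 `^ p < 2 `^ q :> R.
Proof.
move=> pq; rewrite /powR (_ : (2 : R) == 0 = false); last by apply/negbTE.
by rewrite ltr_expR ltr_pM2r// ln_gt0// ltr1n.
Qed.

Lemma tail_le_powR s : 0 < s -> s < t ->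
  exists2 A, 0 < A & forall u, 0 < u -> G u <= A * u `^ (- s).
Proof.
move=> s0 st; have [u0 u00 Hu] : exists2 u0, 0 < u0 & forall u, u0 <= u ->
  G (2 * u) <= 2 `^ (- s) * G u.
  by apply: tail_dilation_le => //; apply: powR2_lt; lra.
pose M := Num.max (u0 `^ s) ((2 * u0) `^ s).
have M0 : 0 < M by rewrite lt_max powR_gt0.
exists M => // u u0'.
suff : G u * u `^ s <= M.
  by rewrite powRN -ler_pdivlMr ?powR_gt0// mulrC.
have Gp v : 0 <= v -> v <= 2 * u0 -> G v * v `^ s <= (2 * u0) `^ s.
  move=> v0 vu; rewrite -[leRHS]mul1r; apply: ler_pM;
    rewrite ?powR_ge0 ?(ltW (G_gt0 _)) ?G_le1//.
  by apply: ge0_ler_powR => //; rewrite ?nnegrE; lra.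
have [uu0|/ltW uu0] := leP u0 u; last first.
  by rewrite le_max Gp ?orbT//; lra.
apply: (doubling_bound (phi := fun u => G u * u `^ s) u00 _ _ uu0) => v.
  move=> u0v; rewrite powRM//; last by lra.
  have v0 : 0 <= v by lra.
  have := Hu _ u0v; rewrite powRN ler_pdivlMl ?powR_gt0// => le1.
  rewrite mulrA ler_wpM2r ?powR_ge0// mulrC.
  exact: le1.
by move=> /andP[v1 v2]; rewrite le_max Gp ?orbT//; lra.
Qed.

Lemma tail_ge_powR p : t < p -> 0 < p ->
  exists2 A, 0 < A & exists2 u0, 0 < u0 & forall u, u0 <= u ->
    A * u `^ (- p) <= G u.
Proof.
move=> tp p0; have [u0 u00 Hu] : exists2 u0, 0 < u0 & forall u, u0 <= u ->
  2 `^ (- p) * G u <= G (2 * u).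
  by apply: tail_dilation_ge => //; apply: powR2_lt; lra.
pose m := G (2 * u0) * u0 `^ p.
have m0 : 0 < m by rewrite mulr_gt0 ?powR_gt0.
exists m => //; exists u0 => // u uu0.
rewrite powRN ler_pdivrMr ?powR_gt0//; last by lra.
rewrite -lerN2.
apply: (doubling_bound (phi := fun u => - (G u * u `^ p)) u00 _ _ uu0) => v.
  move=> u0v; rewrite lerN2 powRM//; last by lra.
  have := Hu _ u0v; rewrite powRN ler_pdivrMl ?powR_gt0// => le1.
  by rewrite mulrA ler_wpM2r ?powR_ge0// mulrC.
move=> /andP[v1 v2]; rewrite lerN2 /m; apply: ler_pM;
  rewrite ?powR_ge0 ?(ltW (G_gt0 _)) ?G_le1//.
  exact: G_noninc.
by apply: ge0_ler_powR => //; rewrite ?nnegrE; lra.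
Qed.

(** The square is needed because a factor [1 - delta] is lost twice, in passing
    to a finite sum and in singling out the jump.  The dilations
    [expR (- k)] and [expR k] below have asymptotic tail ratios [expR (t k)] and
    [expR (- t k)], and enclose [(1 - delta) ^+ 2] and [(1 + delta) ^+ 2]. *)
Lemma tail_perturb eta : 0 < t -> 0 < eta ->
  exists delta, exists2 u0, 0 < u0 & [/\ 0 < delta, delta <= 10^-1 &
    forall u, u0 <= u -> G ((1 - delta) ^+ 2 * u) <= (1 + eta) * G u /\
                         (1 - eta) * G u <= G ((1 + delta) ^+ 2 * u)].
Proof.
move=> t0 e0.
pose k := ln (1 + eta) / (2 * t).
have ln0 : 0 < ln (1 + eta) by rewrite ln_gt0//; lra.
have k0 : 0 < k by rewrite divr_gt0// mulr_gt0.
have tk : t * k = ln (1 + eta) / 2 by rewrite /k; field; lra.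
have lne : ln (1 + eta) <= eta by apply: le_ln1Dx; lra.
have powE x : expR x `^ (- t) = expR (- (t * x)).
  by rewrite -expRM mulrN mulrC.
have [u1 u10 H1] : exists2 u0, 0 < u0 & forall u, u0 <= u ->
  G (expR (- k) * u) <= (1 + eta) * G u.
  apply: tail_dilation_le; rewrite ?expR_gt0// powE mulrN opprK tk.
  by rewrite -[ltRHS]lnK ?posrE ?ltr_expR; lra.
have [u2 u20 H2] : exists2 u0, 0 < u0 & forall u, u0 <= u ->
  (1 - eta) * G u <= G (expR k * u).
  apply: tail_dilation_ge; rewrite ?expR_gt0// powE.
  by apply: lt_le_trans (expR_ge1Dx _); rewrite tk; lra.
have ek : expR (- k) < 1 by rewrite expR_lt1; lra.
have ek1 : 1 + k <= expR k by exact: expR_ge1Dx.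
pose delta := Num.min (Num.min ((1 - expR (- k)) / 2) (k / 3)) 10^-1.
have d0 : 0 < delta by rewrite !lt_min; apply/andP; split; [apply/andP; split|];
  lra.
have [d1 d2 d3] : [/\ delta <= (1 - expR (- k)) / 2,
  delta <= k / 3 & delta <= 10^-1].
  by split; rewrite /delta !ge_min lexx ?orbT.
exists delta; exists (Num.max u1 u2); first by rewrite lt_max u10.
split => // u; rewrite ge_max => /andP[u1u u2u].
split.
  apply: le_trans (H1 _ u1u); apply: G_noninc.
  rewrite ler_wpM2r//; first by lra.
  nra.
apply: le_trans (H2 _ u2u) _; apply: G_noninc.
rewrite ler_wpM2r//; first by lra.
nra.
Qed.

End RegularlyVaryingTail.

Lemma slowly_varying_tail G h t : slowly_varying h ->
  (\forall y \near +oo, G y = h y / y `^ t) -> regularly_varying_tail G t.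
Proof.
move=> [_ h0 hsv] GE lambda l0.
rewrite -[_ `^ _]mulr1.
apply: (@cvg_trans _ ((lambda `^ (- t) * (h (lambda * u) / h u)) @[u --> +oo]));
  last first.
  by apply: cvgM; [exact: cvg_cst|exact: hsv].
apply: near_eq_cvg; near=> u.
have u0 : 0 < u by near: u; exact: nbhs_pinfty_gt.
have -> : G u = h u / u `^ t by near: u.
have -> : G (lambda * u) = h (lambda * u) / (lambda * u) `^ t.
  near: u; move: GE => [M [_ HM]]; exists (Num.max 0 (M / lambda)); split;
    first exact: num_real.
  move=> u /=; rewrite gt_max => /andP[_ Mu]; apply: HM.
  by rewrite mulrC -ltr_pdivrMr.
rewrite powRM ?ltW// powRN.
have := h0 _ u0; have := powR_gt0 t u0; have := powR_gt0 t l0.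
set a := _ `^ t; set b := _ `^ t; set e := h u; set e' := h _ => a0 b0 e0.
by field; rewrite !gt_eqF.
Unshelve. all: by end_near. Qed.

End RegularVariation.

(** * The exponent of the Chernoff bound *)
Section Exponent.
Context {R : realType}.

Lemma powR_le_exp (s k x : R) : 0 < s -> 0 < k -> 0 <= x ->
  x `^ s <= (s / k) `^ s * expR (k * x).
Proof.
move=> s0 k0 x0.
have -> : expR (k * x) = expR (k * x / s) `^ s.
  by rewrite -expRM; congr expR; field; lra.
have sk0 : 0 < s / k by rewrite divr_gt0.
rewrite -powRM ?expR_ge0 ?(ltW sk0)//.
have le1 : k * x / s <= expR (k * x / s) by apply: le_trans (expR_ge1Dx _); lra.
have le2 : x <= s / k * expR (k * x / s).
  by rewrite -ler_pdivrMl//; apply: le_trans le1; rewrite le_eqVlt; apply/orP;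
    left; apply/eqP; field; lra.
by apply: ge0_ler_powR => //; rewrite ?nnegrE; [exact: ltW|exact: le_trans le2].
Qed.

(** Here [lambda * y = 2 * L]; half of it absorbs the quadratic term, which is
    at most [L] by the two conditions [25 * ln U^-1 <= y ^+ 2] and [40 * (2 * t
    - 1) <= y]. The truncation level [eps = 1 / (12 t)] is so small that the
    factor [expR (2 eps L)], together with the powers of [L], is beaten by
    [Num.sqrt U] and by [y `^ (- s)]. *)
Lemma chernoff_exponent_le (t A s : R) : 2 < t -> 0 < A -> 2 < s ->
  exists2 y1, 1 < y1 & forall y U, y1 <= y -> 0 < U -> U <= 1 ->
    25 * ln U^-1 <= y ^+ 2 ->
    let L := 2 * ln U^-1 + (2 * t - 1) * ln y in
    let lambda := 2 * L / y in
    0 < L /\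
    - (lambda * y) + 2 * lambda ^+ 2 +
      expR (lambda * ((12 * t)^-1 * y)) * (A * (2 * lambda) `^ s * Num.sqrt U)
      <= - L + 1.
Proof.
move=> t2 A0 s2.
pose eps : R := (12 * t)^-1.
have eps0 : 0 < eps by rewrite invr_gt0; lra.
have epst : eps * t = 12^-1 by rewrite /eps; field; lra.
pose K := A * (s / eps) `^ s * 4 `^ s.
have K0 : 0 < K by rewrite !mulr_gt0 ?powR_gt0// divr_gt0//; lra.
exists (Num.max 2 (Num.max (40 * (2 * t - 1)) K));
  first by rewrite lt_max ltr1n.
move=> y U; rewrite !ge_max => /and3P[y2 yt yK] U0 U1 yU L lambda.
have y0 : 0 < y by lra.
set l := ln U^-1 in yU L lambda *.
have l0 : 0 <= l by rewrite ln_ge0// invf_ge1.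
have lny0 : 0 < ln y by rewrite ln_gt0//; lra.
have lny : ln y < y by exact: ln_sublinear.
have L0 : 0 < L.
  by rewrite ltr_wpDl ?mulr_ge0// mulr_gt0//; lra.
split => //.
have ly : lambda * y = 2 * L by rewrite /lambda; field; lra.
have quad : 2 * lambda ^+ 2 <= L.
  have -> : 2 * lambda ^+ 2 = L * (8 * L / y ^+ 2) by rewrite /lambda; field;
    lra.
  rewrite -[leRHS]mulr1 ler_pM2l// ler_pdivrMr ?exprn_gt0// mul1r /L.
  have : 40 * (2 * t - 1) * ln y <= y ^+ 2.
    by rewrite expr2; apply: ler_pM => //; lra.
  by lra.
suff small : expR (lambda * (eps * y)) * (A * (2 * lambda) `^ s * Num.sqrt U) <=
  1.
  by move: small; rewrite -/eps ly; lra.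
have le4 : (2 * lambda) `^ s <=
  4 `^ s * (s / eps) `^ s * expR (eps * L) * y `^ (- s).
  have -> : 2 * lambda = 4 * L * y^-1 by rewrite /lambda; field; lra.
  rewrite powRM ?invr_ge0; [|by lra|by lra].
  rewrite powRM; [|by []|by lra].
  have -> : y^-1 `^ s = y `^ (- s) by rewrite -powR_inv1 ?ltW// -powRrM mulN1r.
  rewrite ler_wpM2r ?powR_ge0// -mulrA ler_wpM2l ?powR_ge0//.
  by apply: powR_le_exp => //; lra.
have sqrtE : Num.sqrt U = expR (- (l / 2)).
  by rewrite -powR12_sqrt ?ltW// /powR gt_eqF// /l lnV ?posrE// mulNr opprK
    mulrC.
have yE r : y `^ r = expR (r * ln y) by rewrite /powR gt_eqF.
apply: (@le_trans _ _ (expR (2 * eps * L) *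
   (A * (4 `^ s * (s / eps) `^ s * expR (eps * L) * y `^ (- s)) * expR
     (- (l / 2))))).
  rewrite sqrtE; have -> : lambda * (eps * y) = 2 * eps * L by rewrite /lambda;
    field; lra.
  rewrite ler_pM2l ?expR_gt0// ler_pM2r ?expR_gt0// ler_pM2l//.
have -> : expR (2 * eps * L) *
  (A * (4 `^ s * (s / eps) `^ s * expR (eps * L) * y `^ (- s)) *
    expR (- (l / 2))) = K * expR (3 * eps * L - s * ln y - l / 2).
  have -> : 3 * eps * L - s * ln y - l / 2 =
    2 * eps * L + (eps * L + (- s * ln y - l / 2)) by ring.
  rewrite yE !expRD /K; ring.
rewrite -ler_pdivlMl// mulr1 -[leRHS]lnK ?posrE ?invr_gt0// ler_expR lnV
  ?posrE//.
have : ln K <= ln y by rewrite ler_ln ?posrE.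
have -> : 3 * eps * L = 6 * eps * l + (6 * (eps * t) - 3 * eps) * ln y by
  rewrite /L; ring.
have e24 : eps <= 24^-1 by nra.
have : 6 * eps * l <= l / 4 by nra.
rewrite epst.
have : (6 / 12 - 3 * eps) * ln y <= ln y / 2 by nra.
nra.
Qed.

Lemma expR_chernoff_exponent (t U y : R) : 0 < U -> 0 < y ->
  expR (- (2 * ln U^-1 + (2 * t - 1) * ln y) + 1) =
    expR 1 * U ^+ 2 * y `^ (- (2 * t - 1)).
Proof.
move=> U0 y0; rewrite /powR gt_eqF// -[in RHS](lnK U0) -expRM_natl -!expRD.
by congr expR; rewrite lnV ?posrE//; ring.
Qed.

End Exponent.

(** * Power sums of the weights *)
Section EsumFset.
Context {R : realType} {I : choiceType}.
Variables (F : I -> R) (v : R).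
Hypothesis Fv : (\esum_(i in [set: I]) (F i)%:E = v%:E)%E.

Lemma fset_sum_le_esum (A : {fset I}) : \sum_(i <- A) F i <= v.
Proof.
rewrite -lee_fin -Fv; apply: esum_ge; exists [set` A]; first by split => //;
  exact: finite_fset.
by rewrite -sumEFin fsbig_finite//= set_fsetK.
Qed.

Lemma fset_sum_gt_esum v' : v' < v -> exists A : {fset I},
  v' < \sum_(i <- A) F i.
Proof.
rewrite -lte_fin -Fv => /ereal_sup_gt[_ [X [finX _] <-]].
rewrite fsbig_finite//= sumEFin lte_fin => lt_v.
by exists (fset_set X).
Qed.

End EsumFset.

Lemma le_fset_sum {R : realType} {I : choiceType} (F : I -> R)
  (A B : {fset I}) :
  (forall i, 0 <= F i) -> (A `<=` B)%fset ->
  \sum_(i <- A) F i <= \sum_(i <- B) F i.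
Proof.
move=> F0 AB; rewrite [leRHS](big_fsetID _ (mem A))/=.
rewrite (_ : [fset x in B | x \in A]%fset = A); first by rewrite lerDl sumr_ge0.
by apply/fsetP => i; rewrite !inE/=; apply/andP/idP => [[]//|iA]; split => //;
  exact: (fsubsetP AB).
Qed.

Section Weights.
Context {R : realType} {I : choiceType}.
Variables (c : I -> R) (t U : R) (A : {fset I}).
Hypothesis c_gt0 : forall i, 0 < c i.
Hypothesis t2 : 2 < t.
Hypothesis U0 : 0 < U.
Hypothesis c_sq : \sum_(i <- A) c i ^+ 2 <= 1.

(** The exponents 2, [(t + 2) / 2], [t] and [2 t - 2] are [2 + n (t - 2) / 2]
    for [n] equal to 0, 1, 2 and 4, so that power sums become sums of [z ^+ n]
    with weights [c ^+ 2]. *)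
Let z i := c i `^ ((t - 2) / 2).

Let powR_split i (n : nat) : c i `^ (2 + n%:R * ((t - 2) / 2)) =
  c i ^+ 2 * z i ^+ n.
Proof.
rewrite powRD; last by apply/implyP => _; rewrite gt_eqF.
rewrite powR_mulrn ?ltW//; congr (_ * _).
by rewrite mulrC powRrM powR_mulrn ?powR_ge0.
Qed.

Let ct i : c i `^ t = c i ^+ 2 * z i ^+ 2.
Proof. by rewrite -powR_split; congr (_ `^ _); field. Qed.

(** Cauchy-Schwarz: [(t + 2) / 2] is the midpoint of 2 and [t], and the squares
    have sum at most 1. *)
Lemma sum_powR_midpoint_le : \sum_(i <- A) c i `^ t <= U ->
  \sum_(i <- A) c i `^ ((t + 2) / 2) <= Num.sqrt U.
Proof.
move=> sumU; set r := Num.sqrt U.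
have r0 : 0 < r by rewrite sqrtr_gt0.
have rU : r ^+ 2 = U by rewrite sqr_sqrtr// ltW.
have : \sum_(i <- A) 2 * r * c i `^ ((t + 2) / 2) <=
    \sum_(i <- A) (c i `^ t + r ^+ 2 * c i ^+ 2).
  apply: ler_sum => i _; rewrite ct.
  have -> : (t + 2) / 2 = 2 + 1%:R * ((t - 2) / 2) by field.
  rewrite powR_split expr1.
  have := mulr_ge0 (sqr_ge0 (c i)) (sqr_ge0 (z i - r)); nra.
rewrite -mulr_sumr big_split/= -mulr_sumr.
set x := \sum_(_ <- _) _ => le1.
have le2 : r ^+ 2 * \sum_(i <- A) c i ^+ 2 <= r ^+ 2.
  by rewrite -[leRHS]mulr1 ler_wpM2l// sqr_ge0.
have : 2 * r * x <= 2 * r * r by move: le1 le2 sumU; rewrite -rU; lra.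
by rewrite ler_pM2l// mulr_gt0.
Qed.

(** Linearised Cauchy-Schwarz, with [t] the midpoint of 2 and [2 t - 2]. This
    form is linear in the finite power sums, so it is still strong when [A]
    captures only a part of the total [U]. *)
Lemma sum_powR_double_ge :
  2 * U * (\sum_(i <- A) c i `^ t) - U ^+ 2 <= \sum_(i <- A) c i `^ (2 * t - 2).
Proof.
have : \sum_(i <- A) (2 * U * c i `^ t - U ^+ 2 * c i ^+ 2) <=
    \sum_(i <- A) c i `^ (2 * t - 2).
  apply: ler_sum => i _; rewrite ct.
  have -> : 2 * t - 2 = 2 + 4%:R * ((t - 2) / 2) by field.
  rewrite powR_split.
  have := mulr_ge0 (sqr_ge0 (c i)) (sqr_ge0 (z i ^+ 2 - U)).
  set a := c i ^+ 2; set b := z i; set b4 := b ^+ 4.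
  have -> : b4 = b ^+ 2 * b ^+ 2 by rewrite /b4; ring.
  nra.
apply: le_trans; rewrite sumrB -!mulr_sumr lerD2l lerN2.
by rewrite -[leRHS]mulr1 ler_wpM2l// sqr_ge0.
Qed.

Lemma sum_powR_le kappa : (forall i, c i <= kappa) ->
  \sum_(i <- A) c i `^ t <= kappa `^ (t - 2).
Proof.
move=> ck; apply: (@le_trans _ _ (\sum_(i <- A) kappa `^ (t - 2) * c i ^+ 2));
  last first.
  by rewrite -mulr_sumr -[leRHS]mulr1 ler_wpM2l// powR_ge0.
apply: ler_sum => i _.
have -> : c i `^ t = c i `^ (t - 2) * c i ^+ 2.
  rewrite -powR_mulrn ?ltW// -powRD; last by apply/implyP => _; rewrite gt_eqF.
  by congr (_ `^ _); ring.
rewrite ler_wpM2r ?sqr_ge0//; apply: ge0_ler_powR;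
  rewrite ?nnegrE ?(ltW (c_gt0 _))//.
- by rewrite subr_ge0 ltW.
- exact: le_trans (ltW (c_gt0 i)) _.
Qed.

End Weights.

Lemma esum_le_fset {R : realType} {I : choiceType} (F : I -> R) (v : R) :
  (forall A : {fset I}, \sum_(i <- A) F i <= v) ->
  (\esum_(i in [set: I]) (F i)%:E <= v%:E)%E.
Proof.
move=> Fv; apply: ge_ereal_sup => _ [X [finX _] <-].
by rewrite fsbig_finite//= sumEFin lee_fin.
Qed.

(** * The sum of the individual tails *)
Section WeightedTail.
Context {R : realType} {I : choiceType}.
Variables (c : I -> R) (G : R -> R) (t U V y : R).
Hypothesis c_gt0 : forall i, 0 < c i.
Hypothesis c_sq : forall A : {fset I}, \sum_(i <- A) c i ^+ 2 <= 1.
Hypothesis y_gt0 : 0 < y.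

Let yc_gt0 i : 0 < y / c i. Proof. exact: divr_gt0. Qed.

Lemma weighted_tail_le (A2 : R) (A : {fset I}) :
  0 < A2 -> (forall u, 0 < u -> G u <= A2 * u `^ (- 2)) ->
  \sum_(i <- A) G (y / c i) <= A2 / y ^+ 2.
Proof.
move=> A20 HA2.
apply: (@le_trans _ _ (\sum_(i <- A) A2 / y ^+ 2 * c i ^+ 2)).
  apply: ler_sum => i _; apply: le_trans (HA2 _ (yc_gt0 i)) _.
  rewrite powRN powR_mulrn ?(ltW (yc_gt0 i))//.
  by rewrite exprMn exprVn invfM invrK mulrA.
by rewrite -mulr_sumr -[leRHS]mulr1 ler_wpM2l// divr_ge0 ?sqr_ge0 ?ltW.
Qed.

(** Capturing three quarters of [U] by a finite set of weights is enough: then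
    [2 U (3/4) U - U^2 = U^2 / 2]. *)
Lemma weighted_tail_ge (A3 u3 : R) : 2 < t -> 0 < U ->
  (\esum_(i in [set: I]) (c i `^ t)%:E = U%:E)%E ->
  (\esum_(i in [set: I]) (G (y / c i))%:E = V%:E)%E ->
  0 < A3 -> (forall u, u3 <= u -> A3 * u `^ (- (2 * t - 2)) <= G u) ->
  (forall i, u3 <= y / c i) ->
  A3 / 2 * U ^+ 2 * y `^ (- (2 * t - 2)) <= V.
Proof.
move=> t2 U0 cU VE A30 HA3 yc3.
have [A HA] : exists A : {fset I}, 3 / 4 * U < \sum_(i <- A) c i `^ t.
  by apply: (fset_sum_gt_esum cU); lra.
apply: le_trans (fset_sum_le_esum VE A).
apply: (@le_trans _ _ (\sum_(i <- A) A3 * y `^ (- (2 * t - 2)) * c i `^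
  (2 * t - 2))).
  rewrite -mulr_sumr; set p := y `^ _.
  have -> : A3 / 2 * U ^+ 2 * p = A3 * p * (U ^+ 2 / 2) by field.
  rewrite ler_pM2l ?mulr_gt0 ?powR_gt0//.
  by apply: le_trans (sum_powR_double_ge t U c_gt0 (c_sq A)); nra.
apply: ler_sum => i _; apply: le_trans (HA3 _ (yc3 i)).
rewrite -mulrA ler_pM2l// powRM ?invr_ge0 ?(ltW y_gt0) ?(ltW (c_gt0 i))//.
rewrite ler_pM2l ?powR_gt0// -powR_inv1 ?(ltW (c_gt0 i))// -powRrM mulrN mulN1r
  opprK.
exact: lexx.
Qed.

End WeightedTail.

(** * The principle of a single big jump *)

(** Only the largest weight has to be small, uniformly over all families of
    weights: since [U <= kappa `^ (t - 2)], a small [kappa] makes [U] small and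
    hence [y] large. The infinite sum enters as a variable [Z] approximated in
    mean square by finite sums. The lower bound [u_min] on the arguments [y /
    c] allows [G] to be replaced by any expression it equals near infinity. *)
Lemma single_big_jump {R : realType} {d : measure_display}
    {Omega : measurableType d} {P : probability Omega R} {I : choiceType}
    {Y : I -> {RV P >-> R}} (G : R -> R) (t C eta : R)
    (indepY : mutually_independent Y)
    (intY : forall i, P.-integrable setT (fun w => (Y i w)%:E))
    (intY2 : forall i, P.-integrable setT (fun w => (Y i w ^+ 2)%:E))
    (meanY : forall i, \int[P]_w Y i w = 0)
    (varY : forall i, \int[P]_w (Y i w ^+ 2) = 1)
    (G_tail : forall i u, fine (P [set w | u <= Y i w]) = G u)
    (G_noninc : {homo G : u v / u <= v >-> v <= u})
    (G_gt0 : forall u, 0 < G u) (G_le1 : forall u, G u <= 1)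
    (G_rv : regularly_varying_tail G t)
    (t2 : 2 < t) (C9 : 50 / 9 <= C) (eta0 : 0 < eta) (eta1 : eta < 1)
    (u_min : R) :
  exists2 kappa : R, 0 < kappa &
  forall (c : I -> R) (y U : R) (Z : Omega -> R),
    (forall i, 0 < c i) -> (forall i, c i <= kappa) ->
    (\esum_(i in [set: I]) (c i ^+ 2)%:E = 1%:E)%E ->
    (\esum_(i in [set: I]) (c i `^ t)%:E = U%:E)%E -> 0 < U ->
    C * Num.sqrt (ln U^-1) <= y ->
    measurable_fun setT Z ->
    (forall (tau : R) (B : {fset I}), 0 < tau -> exists2 A, (B `<=` A)%fset &
      (\int[P]_w ((Z w - \sum_(i <- A) c i * Y i w) ^+ 2)%:E <= tau%:E)%E) ->
    exists2 V : R, 0 < V &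
      [/\ (\esum_(i in [set: I]) (G (y / c i))%:E = V%:E)%E,
          forall i, u_min <= y / c i &
          (1 - eta) * V <= fine (P [set w | y <= Z w]) <= (1 + eta) * V].
Proof.
pose e := eta / 8.
have e0 : 0 < e by rewrite /e; lra.
have e8 : e < 8^-1 by rewrite /e; lra.
have t0 : 0 < t by lra.
have [delta [u0 u00 [d0 d10 Hpert]]] := tail_perturb G_noninc G_gt0 G_rv t0 e0.
have [A1 A10 HA1] : exists2 A, 0 < A & forall u, 0 < u ->
  G u <= A * u `^ (- ((t + 2) / 2)).
  by apply: (tail_le_powR G_gt0 G_le1 G_rv); lra.
have [A2 A20 HA2] : exists2 A, 0 < A & forall u, 0 < u -> G u <= A * u `^ (- 2).
  by apply: (tail_le_powR G_gt0 G_le1 G_rv); lra.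
have [A3 A30 [u3 u30 HA3]] : exists2 A, 0 < A & exists2 u0, 0 < u0 &
    forall u, u0 <= u -> A * u `^ (- (2 * t - 2)) <= G u.
  by apply: (tail_ge_powR G_noninc G_gt0 G_rv); lra.
pose eps : R := (12 * t)^-1.
have eps0 : 0 < eps by rewrite invr_gt0; lra.
have ed0 : 0 < eps * (1 - delta) by rewrite mulr_gt0//; lra.
pose K := Num.max 1 ((eps * (1 - delta)) `^ (- t) + 1).
have K1 : 1 <= K by rewrite le_max lexx.
have [u4 u40 HK] : exists2 u0, 0 < u0 & forall u, u0 <= u ->
    G (eps * (1 - delta) * u) <= K * G u.
  by apply: (tail_dilation_le G_gt0 G_rv ed0); rewrite lt_max ltrDl ltr01 orbT.
have [y1 y11 Hexp] : exists2 y1, 1 < y1 & forall y U, y1 <= y -> 0 < U ->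
  U <= 1 ->
    25 * ln U^-1 <= y ^+ 2 ->
    let L := 2 * ln U^-1 + (2 * t - 1) * ln y in
    let lambda := 2 * L / y in
    0 < L /\ - (lambda * y) + 2 * lambda ^+ 2 +
      expR (lambda * (eps * y)) * (A1 * (2 * lambda) `^ ((t + 2) / 2) * Num.sqrt
        U) <= - L + 1.
  by apply: chernoff_exponent_le => //; lra.
(* For y >= D the Chernoff bound, at a threshold above y / 2, is at most e V. *)
pose D := expR 1 * 2 `^ (2 * t - 1) * (2 / A3) / e.
have D0 : 0 < D by rewrite !mulr_gt0 ?expR_gt0 ?powR_gt0 ?invr_gt0.
pose M := 2 * y1 + A2 / e + (2 / delta) * (1 + K / e) + D.
have A2e : 0 < A2 / e by exact: divr_gt0.
have Ke : 0 < K / e by apply: divr_gt0 => //; lra.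
have de : 0 < (2 / delta) * (1 + K / e) by rewrite mulr_gt0 ?divr_gt0//; lra.
have M0 : 0 < M by rewrite /M; clear -y11 A2e de D0; lra.
pose um := u0 + u3 + u4 + `|u_min|.
have umin_norm := ler_norm u_min; have norm0 := normr_ge0 u_min.
have um0 : 0 < um by rewrite /um; clear -u00 u30 u40 norm0; lra.
(* The first bound makes all arguments y / c large, the second makes y >= M. *)
pose kappa := Num.min um^-1 (expR (- (M / C) ^+ 2 / (t - 2))).
have k0 : 0 < kappa by rewrite lt_min invr_gt0 um0 expR_gt0.
exists kappa => // c y U Z c0 ck c2 cU U0 yC mZ ZA.
have C0 : 0 < C by lra.
have sumc2 (A : {fset I}) : \sum_(i <- A) c i ^+ 2 <= 1.
  by exact: (@fset_sum_le_esum _ _ (fun i => c i ^+ 2) 1).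
have sumcU (A : {fset I}) : \sum_(i <- A) c i `^ t <= U.
  by exact: (@fset_sum_le_esum _ _ (fun i => c i `^ t) U).
have U_le : U <= expR (- (M / C) ^+ 2).
  rewrite -lee_fin -cU; apply: esum_le_fset => A.
  apply: le_trans (sum_powR_le c0 t2 (sumc2 A) ck) _.
  apply: (@le_trans _ _ (expR (- (M / C) ^+ 2 / (t - 2)) `^ (t - 2))).
    apply: ge0_ler_powR; rewrite ?nnegrE ?expR_ge0 ?(ltW k0)//;
      first by rewrite subr_ge0 ltW.
    by rewrite /kappa ge_min lexx orbT.
  by rewrite -expRM divfK//; lra.
have lnU : (M / C) ^+ 2 <= ln U^-1.
  by rewrite lnV ?posrE// lerNr -[leRHS]expRK ler_ln ?posrE ?expR_gt0.
have U1 : U <= 1 by apply: le_trans U_le _; rewrite expR_le1 oppr_le0 sqr_ge0.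
have lnU0 : 0 <= ln U^-1 by apply: le_trans lnU; rewrite sqr_ge0.
have sqrt0 : 0 <= Num.sqrt (ln U^-1) by exact: sqrtr_ge0.
have yM : M <= y.
  apply: (le_trans _ yC); rewrite mulrC -ler_pdivrMr//.
  have MC0 : 0 <= M / C by rewrite divr_ge0// ltW.
  by rewrite -[leLHS](ger0_norm MC0) -sqrtr_sqr ler_sqrt.
have y0 : 0 < y by exact: lt_le_trans yM.
have [y2y1 yA2 yd yD] : [/\ 2 * y1 <= y, A2 / e <= y,
  2 / delta * (1 + K / e) <= y & D <= y].
  by move: yM; rewrite /M; clear -y11 A2e de D0; split; lra.
have yge1 : 1 <= y by clear -y11 y2y1; lra.
have yc i : um <= y / c i.
  rewrite ler_pdivlMr//; apply: le_trans yge1.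
  rewrite mulrC -ler_pdivlMr// mul1r; apply: le_trans (ck i) _.
  by rewrite /kappa ge_min lexx.
have yc0 i : 0 < y / c i by exact: divr_gt0.
have [ycu0 ycu3 ycu4 ycm] : [/\ forall i, u0 <= y / c i, forall i,
  u3 <= y / c i,
    forall i, u4 <= y / c i & forall i, u_min <= y / c i].
  by split => i; have := yc i; rewrite /um; clear -u00 u30 u40 umin_norm norm0;
    lra.
have G0 u : 0 <= G u by exact: ltW.
have Vle (A : {fset I}) := weighted_tail_le c0 sumc2 y0 A A20 HA2.
have [V VE] : exists V, (\esum_(i in [set: I]) (G (y / c i))%:E = V%:E)%E.
  exists (fine (\esum_(i in [set: I]) (G (y / c i))%:E)); rewrite fineK//.
  rewrite ge0_fin_numE; last by apply: esum_ge0 => i _; rewrite lee_fin.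
  exact: le_lt_trans (esum_le_fset Vle) (ltry _).
have V_le : V <= e.
  have : V <= A2 / y ^+ 2 by rewrite -lee_fin -VE; exact: esum_le_fset.
  move=> /le_trans; apply; rewrite ler_pdivrMr ?exprn_gt0//.
  have : A2 <= e * y by move: yA2; rewrite ler_pdivrMr// mulrC.
  by move=> /le_trans; apply; rewrite ler_pM2l// expr2 ler_peMr// ltW.
have V_ge := weighted_tail_ge c0 sumc2 y0 t2 U0 cU VE A30 HA3 ycu3.
have V0 : 0 < V.
  by apply: lt_le_trans V_ge; rewrite !mulr_gt0 ?powR_gt0 ?exprn_gt0 ?invr_gt0.
exists V => //; split => //.
have Gsum_le (A : {fset I}) : \sum_(i <- A) G (y / c i) <=
  V := fset_sum_le_esum VE A.
have [B HB] : exists B : {fset I}, (1 - e) * V < \sum_(i <- B) G (y / c i).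
  by apply: (fset_sum_gt_esum VE); rewrite gtr_pMl//; clear -e0; lra.
have dy0 : 0 < delta * y by exact: mulr_gt0.
have [A BA HA] : exists2 A, (B `<=` A)%fset &
    (\int[P]_w ((Z w - \sum_(i <- A) c i * Y i w) ^+ 2)%:E <=
     (e * V * (delta * y) ^+ 2)%:E)%E.
  by apply: ZA; rewrite !mulr_gt0// exprn_gt0.
pose S w := \sum_(i <- A) c i * Y i w.
have mS : measurable_fun setT S by exact: measurable_lincomb.
have approx : fine (P [set w | delta * y <= `|Z w - S w|]) <= e * V.
  apply: le_trans (pr_second_moment _ dy0 HA) _; first exact: measurable_funB.
  by rewrite mulfK// gt_eqF// exprn_gt0.
have mdiff : measurable [set w | delta * y <= `|Z w - S w|].
  by apply: measurable_superlevel; apply: measurableT_comp => //;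
    exact: measurable_funB.
(* The error of the finite sum costs a margin delta y and a probability e V. *)
have transfer (F1 F2 : Omega -> R) u v : measurable_fun setT F1 ->
  measurable_fun setT F2 ->
    (forall w, u <= F1 w -> `|Z w - S w| < delta * y -> v <= F2 w) ->
    fine (P [set w | u <= F1 w]) <= fine (P [set w | v <= F2 w]) + e * V.
  move=> mF1 mF2 F12.
  apply: (@le_trans _ _ (fine (P
    ([set w | v <= F2 w] `|` [set w | delta * y <= `|Z w - S w|])))).
    apply: le_pr; [exact: measurable_superlevel| |].
      by apply: measurableU => //; exact: measurable_superlevel.
    move=> w /= uF1; have [|lt1] := leP (delta * y) `|Z w - S w|;
      first by right.
    by left; exact: F12 lt1.
  apply: le_trans (pr_setU_le _ mdiff) _; first exact: measurable_superlevel.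
  by rewrite lerD2l.
have large_y r : y / 2 <= r -> (1 + K / e) <= delta * r.
  move=> yr; have : 1 + K / e <= delta * (y / 2).
    rewrite mulrA [delta * y]mulrC -mulrA.
    have -> : y * (delta / 2) = y / (2 / delta) by field; rewrite gt_eqF.
    by rewrite ler_pdivlMr ?divr_gt0// mulrC.
  by move=> /le_trans; apply; rewrite ler_pM2l.
have inv_sq r : y / 2 <= r -> K / (delta * r) ^+ 2 <= e.
  move=> yr; have := large_y _ yr; set q := delta * r => q1.
  have q0 : 0 < q by clear -q1 Ke; lra.
  rewrite ler_pdivrMr ?exprn_gt0//.
  have : K <= e * q by rewrite mulrC -ler_pdivrMr//; clear -q1; lra.
  move=> /le_trans; apply; rewrite ler_pM2l// expr2 ler_peMl ?(ltW q0)//.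
  by clear -q1 Ke; lra.
apply/andP; split.
- pose y' := (1 + delta) * y.
  have y'0 : 0 < y' by rewrite mulr_gt0//; clear -d0; lra.
  have yy' : y / 2 <= y' by rewrite /y'; clear -d0 y0; nra.
  pose W := \sum_(i <- A) G ((1 + delta) * y' / c i).
  have arg i : (1 + delta) * y' / c i = (1 + delta) ^+ 2 * (y / c i).
    by rewrite /y' expr2 !mulrA.
  have W_le : W <= V.
    apply: le_trans (Gsum_le A); apply: ler_sum => i _; rewrite arg.
    apply: G_noninc; rewrite ler_peMl ?(ltW (yc0 i))//; clear -d0; nra.
  have W_ge : (1 - e) ^+ 2 * V <= W.
    apply: (@le_trans _ _ ((1 - e) * \sum_(i <- A) G (y / c i))).
      rewrite expr2 -mulrA ler_pM2l; last by clear -e8; lra.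
      by apply: le_trans (ltW HB) _; apply: le_fset_sum.
    rewrite mulr_sumr; apply: ler_sum => i _; rewrite arg.
    by have [] := Hpert _ (ycu0 i).
  have := pr_sum_ge_lower indepY intY intY2 meanY varY c0 G_tail G0 (sumc2 A)
    y'0 d0.
  rewrite -/W => low.
  have : fine (P [set w | y' <= S w]) <= fine (P [set w | y <= Z w]) + e * V.
    apply: transfer => // w; rewrite /y' => H1;
      rewrite ltr_norml => /andP[H2 _].
    by clear -H1 H2; lra.
  have : (delta * y') ^- 2 <= e.
    apply: le_trans (inv_sq _ yy'); rewrite -[leLHS]mul1r ler_wpM2r//.
    by rewrite invr_ge0 sqr_ge0.
  move: low; rewrite -/(S _); set p := fine _; set p' := fine _;
    set x := _ ^- 2.
  move=> low x_le pp.
  have : W * (1 - x) - W ^+ 2 >= W * (1 - 2 * e).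
    have W0 : 0 <= W by apply: sumr_ge0.
    by clear -W0 W_le V_le x_le; nra.
  have : W * (1 - 2 * e) >= (1 - e) ^+ 2 * V * (1 - 2 * e).
    by rewrite ler_wpM2r//; clear -e8; lra.
  have : (1 - e) ^+ 2 * V * (1 - 2 * e) >= (1 - 4 * e) * V.
    by rewrite [leRHS]mulrAC ler_pM2r//; clear -e0 e8; nra.
  have -> : eta = 8 * e by rewrite /e; field.
  have : 0 <= e * V by rewrite mulr_ge0// ltW.
  by clear -low pp; lra.
- pose y' := (1 - delta) * y.
  have y'0 : 0 < y' by rewrite mulr_gt0//; clear -d10; lra.
  have yy' : y / 2 <= y' by rewrite /y'; clear -d10 y0; nra.
  have tr : fine (P [set w | y <= Z w]) <= fine (P [set w | y' <= S w]) + e * V.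
    apply: transfer => // w; rewrite /y' => H1;
      rewrite ltr_norml => /andP[_ H2].
    by clear -H1 H2; lra.
  have := pr_sum_ge_split indepY intY intY2 meanY varY c0 G_tail G0 (sumc2 A)
    eps y'0 d0.
  have term1 : \sum_(i <- A) G ((1 - delta) * y' / c i) <= (1 + e) * V.
    apply: (@le_trans _ _ ((1 + e) * \sum_(i <- A) G (y / c i))); last first.
      by rewrite ler_pM2l//; clear -e0; lra.
    rewrite mulr_sumr; apply: ler_sum => i _.
    have -> : (1 - delta) * y' / c i = (1 - delta) ^+ 2 * (y / c i).
      by rewrite /y' expr2 !mulrA.
    by have [] := Hpert _ (ycu0 i).
  have term2 : (\sum_(i <- A) G (eps * y' / c i)) / (delta * y') ^+ 2 <= e * V.
    apply: (@le_trans _ _ (K * V / (delta * y') ^+ 2)); last first.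
      by rewrite mulrAC ler_pM2r// inv_sq.
    rewrite ler_wpM2r ?invr_ge0 ?sqr_ge0//.
    apply: (@le_trans _ _ (K * \sum_(i <- A) G (y / c i))); last first.
      by rewrite ler_pM2l//; clear -K1; lra.
    rewrite mulr_sumr; apply: ler_sum => i _.
    have -> : eps * y' / c i = eps * (1 - delta) * (y / c i).
      by rewrite /y' !mulrA.
    exact: HK.
  have term3 : fine (P ([set w | y' <= S w] `\`
      [set w | exists2 i, i \in A & eps * y' <= c i * Y i w])) <= e * V.
    have y'y1 : y1 <= y' by apply: le_trans yy'; clear -y2y1; lra.
    have y'U : 25 * ln U^-1 <= y' ^+ 2.
      have le5 : 5 * Num.sqrt (ln U^-1) <= y'.
        apply: (@le_trans _ _ ((1 - delta) * (C * Num.sqrt (ln U^-1)))).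
          by rewrite mulrA ler_wpM2r//; clear -C9 d10; nra.
        by rewrite ler_pM2l//; clear -d10; lra.
      rewrite -[ln U^-1]sqr_sqrtr//.
      have -> : 25 * Num.sqrt (ln U^-1) ^+ 2 =
        (5 * Num.sqrt (ln U^-1)) ^+ 2 by ring.
      by rewrite ler_pXn2r// nnegrE ?(ltW y'0)// mulr_ge0.
    have [] := Hexp _ _ y'y1 U0 U1 y'U.
    set L := 2 * _ + _; set lambda := 2 * L / y' => L0 le_exp.
    have l0 : 0 < lambda by rewrite divr_gt0// mulr_gt0.
    apply: le_trans (pr_sum_no_big_jump indepY intY intY2 meanY varY c0 G_tail
      (sumc2 A) y' eps l0) _.
    have Gl : \sum_(i <- A) G ((2 * lambda)^-1 / c i) <=
        A1 * (2 * lambda) `^ ((t + 2) / 2) * Num.sqrt U.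
      apply: (@le_trans _ _ (\sum_(i <- A) A1 * (2 * lambda) `^ ((t + 2) / 2) *
        c i `^ ((t + 2) / 2))).
        apply: ler_sum => i _; apply: le_trans (HA1 _ _) _.
          by rewrite divr_gt0// invr_gt0 mulr_gt0.
        have l2 : 0 <= 2 * lambda by rewrite ltW// mulr_gt0.
        have lc : 0 <= 2 * lambda * c i by rewrite mulr_ge0// ltW.
        rewrite -mulrA -powRM ?(ltW (c0 i))//.
        rewrite -invfM -[X in X `^ (- _)]powR_inv1//.
        by rewrite -powRrM mulN1r opprK.
      rewrite -mulr_sumr ler_wpM2l ?mulr_ge0 ?powR_ge0 ?(ltW A10)//.
      exact: sum_powR_midpoint_le.
    apply: (@le_trans _ _ (expR (- L + 1))).
      rewrite ler_expR; apply: le_trans le_exp;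
        rewrite lerD2l ler_pM2l ?expR_gt0//.
    rewrite /L expR_chernoff_exponent//.
    set p := 2 * t - 1; set Q := y `^ (- (2 * t - 2)) in V_ge.
    have y'p : y' `^ (- p) <= 2 `^ p * (Q / y).
      apply: (@le_trans _ _ ((y / 2) `^ (- p))).
        rewrite !powRN lef_pV2 ?posrE ?powR_gt0 ?divr_gt0//.
        apply: ge0_ler_powR; rewrite ?nnegrE ?(ltW y'0) ?divr_ge0 ?(ltW y0)//.
        by rewrite /p; clear -t2; lra.
      rewrite powRM ?invr_ge0 ?(ltW y0)// mulrC -powR_inv1// -powRrM mulN1r
        opprK.
      rewrite ler_pM2l ?powR_gt0// /Q -[y^-1]powR_inv1 ?(ltW y0)// -powRD.
        by rewrite le_eqVlt; apply/orP; left; apply/eqP; congr (_ `^ _);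
          rewrite /p; ring.
      by apply/implyP => _; rewrite gt_eqF.
    apply: (@le_trans _ _ (expR 1 * U ^+ 2 * (2 `^ p * (Q / y)))).
      by rewrite ler_pM2l// mulr_gt0 ?expR_gt0 ?exprn_gt0.
    have U2Q : U ^+ 2 * Q <= 2 / A3 * V.
      have -> : U ^+ 2 * Q = 2 / A3 * (A3 / 2 * U ^+ 2 * Q) by field;
        rewrite gt_eqF.
      by rewrite ler_pM2l// divr_gt0.
    have -> : expR 1 * U ^+ 2 * (2 `^ p * (Q / y)) =
      expR 1 * 2 `^ p / y * (U ^+ 2 * Q).
      by field; rewrite gt_eqF.
    apply: (@le_trans _ _ (expR 1 * 2 `^ p / y * (2 / A3 * V))).
      by rewrite ler_pM2l// !mulr_gt0 ?expR_gt0 ?powR_gt0 ?invr_gt0.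
    have -> : expR 1 * 2 `^ p / y * (2 / A3 * V) = e * V * (D / y).
      by rewrite /D -/p; field; rewrite !gt_eqF.
    by rewrite -[leRHS]mulr1 ler_pM2l ?mulr_gt0// ler_pdivrMr// mul1r.
  rewrite -/S.
  have -> : eta = 8 * e by rewrite /e; field.
  have : 0 <= e * V by rewrite mulr_ge0// ltW.
  move: tr term1 term2 term3; clear.
  set p1 := fine _; set p2 := fine _; set p3 := fine _.
  set s1 := \sum_(_ <- _) _; set s2 := _ / _ ^+ 2.
  by lra.
Qed.

(** * From the random field to weighted sums *)
Lemma mutually_independent_comp {d : measure_display} {T : measurableType d}
    {R : realType} {P : probability T R} {I J : choiceType}
    (Y : I -> {RV P >-> R}) (f : J -> I) : injective f ->
  mutually_independent Y -> mutually_independent (fun j => Y (f j)).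
Proof.
move=> finj indY K A mA.
pose A' i := [set x | exists2 j, f j = i & A j x].
have A'f j : A' (f j) = A j.
  by apply/seteqP; split => [x [k /finj->]//|x Ax]; exists j.
have mA' i : measurable (A' i).
  have [[j <-]|nf] := pselect (exists j, f j = i); first by rewrite A'f.
  rewrite (_ : A' i = set0)//; apply/seteqP; split => // x [j fj _].
  by case: nf; exists j.
have := indY (f @` K)%fset A' mA'.
rewrite big_imfset/=; last by move=> ? ? _ _; exact: finj.
under eq_bigr do rewrite A'f.
move=> <-; congr (P _); apply/seteqP; split => w /= H.
  by move=> i /imfsetP[j /= jK ->] /=; rewrite A'f; exact: H.
by move=> j jK; rewrite -A'f; apply: H; exact: in_imfset.
Qed.

Section IdenticalDistribution.
Context {d : measure_display} {T : measurableType d} {R : realType}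
  {P : probability T R}.
Variables X Y : {RV P >-> R}.
Hypothesis XY : forall A, measurable A ->
  distribution P X A = distribution P Y A.

Lemma ge0_integral_same_law (f : R -> R) : measurable_fun setT f ->
  (forall u, 0 <= f u) ->
  (\int[P]_w (f (X w))%:E = \int[P]_w (f (Y w))%:E)%E.
Proof.
move=> mf f0; have mEf : measurable_fun setT (EFin \o f) by
  exact/measurable_EFinP.
rewrite -[LHS](ge0_integral_distribution X mEf); last by move=> u;
  rewrite lee_fin.
rewrite -[RHS](ge0_integral_distribution Y mEf); last by move=> u;
  rewrite lee_fin.
by apply: eq_measure_integral => A mA _; exact: XY.
Qed.

Lemma integrable_same_law (f : R -> R) : measurable_fun setT f ->
  P.-integrable setT (fun w => (f (X w))%:E) ->
  P.-integrable setT (fun w => (f (Y w))%:E).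
Proof.
move=> mf /integrableP[_ intX]; apply/integrableP; split.
  by apply/measurable_EFinP; exact: measurableT_comp.
have <- := ge0_integral_same_law (f := fun u => `|f u|) _ _ => //.
exact: measurableT_comp.
Qed.

Lemma Rintegral_same_law (f : R -> R) : measurable_fun setT f ->
  P.-integrable setT (fun w => (f (X w))%:E) ->
  \int[P]_w f (X w) = \int[P]_w f (Y w).
Proof.
move=> mf intX; have intY := integrable_same_law mf intX.
have mEf : measurable_fun setT (EFin \o f) by exact/measurable_EFinP.
rewrite /Rintegral; congr fine.
rewrite -[LHS](integral_distribution mEf intX)
  -[RHS](integral_distribution mEf intY).
by apply: eq_measure_integral => A mA _; exact: XY.
Qed.

End IdenticalDistribution.

Section L2Approximation.
Context {d : measure_display} {T : measurableType d} {R : realType}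
  {P : probability T R} {I : choiceType}.
Implicit Types (D : {fset I} -> T -> R).

(** Convergence to 0 in L^2 along the finite sets ordered by inclusion. *)
Definition L2_null D := forall tau : R, 0 < tau -> exists B : {fset I},
  forall A, (B `<=` A)%fset -> (\int[P]_w (D A w ^+ 2)%:E <= tau%:E)%E.

Lemma L2_nullD D1 D2 :
  (forall A, measurable_fun setT (D1 A)) ->
    (forall A, measurable_fun setT (D2 A)) ->
  L2_null D1 -> L2_null D2 -> L2_null (fun A w => D1 A w + D2 A w).
Proof.
move=> m1 m2 n1 n2 tau tau0.
have tau4 : 0 < tau / 4 by lra.
have [B1 H1] := n1 _ tau4; have [B2 H2] := n2 _ tau4.
exists (B1 `|` B2)%fset => A; rewrite fsubUset => /andP[/H1 le1 /H2 le2].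
have m1' : measurable_fun setT (fun w => (2 * D1 A w ^+ 2)%:E).
  by apply/measurable_EFinP; apply: measurable_funM => //;
    exact: measurable_funX.
have m2' : measurable_fun setT (fun w => (2 * D2 A w ^+ 2)%:E).
  by apply/measurable_EFinP; apply: measurable_funM => //;
    exact: measurable_funX.
apply: (@le_trans _ _ (\int[P]_w
  ((2 * D1 A w ^+ 2)%:E + (2 * D2 A w ^+ 2)%:E))%E).
  apply: ge0_le_integral => //.
  - by move=> w _; rewrite lee_fin sqr_ge0.
  - by apply/measurable_EFinP; apply: measurable_funX; exact: measurable_funD.
  - exact: emeasurable_funD.
  - move=> w _; rewrite -EFinD lee_fin.
    by have := sqr_ge0 (D1 A w - D2 A w); nra.
have ge w D : (0 <= (2 * D A w ^+ 2)%:E)%E by rewrite lee_fin mulr_ge0//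
  sqr_ge0.
rewrite ge0_integralD//.
have Z D : measurable_fun setT (D A) ->
    (\int[P]_w (2 * D A w ^+ 2)%:E = 2%:E * \int[P]_w (D A w ^+ 2)%:E)%E.
  move=> mD; under eq_integral do rewrite EFinM.
  rewrite ge0_integralZl//; first by apply/measurable_EFinP;
    exact: measurable_funX.
  by move=> w _; rewrite lee_fin sqr_ge0.
rewrite !Z//; have -> : tau%:E = (2%:E * (tau / 4)%:E + 2%:E * (tau / 4)%:E)%E.
  by rewrite -!EFinM -EFinD; congr EFin; field.
by apply: leeD; rewrite lee_pmul2l.
Qed.

Lemma L2_null_sum (J : eqType) (s : seq J) (D : J -> {fset I} -> T -> R) :
  (forall j A, measurable_fun setT (D j A)) -> (forall j, L2_null (D j)) ->
  L2_null (fun A w => \sum_(j <- s) D j A w).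
Proof.
move=> mD nD; elim: s => [|j s IH].
  move=> tau tau0; exists fset0 => A _.
  under eq_integral do rewrite big_nil expr0n.
  by rewrite integral0 lee_fin ltW.
have := L2_nullD (mD j) _ (nD j) IH => /(_ _) H.
move=> tau tau0; have [|B HB] := H _ tau tau0.
  by move=> A; apply: measurable_sum.
exists B => A /HB le_tau.
by under eq_integral do rewrite big_cons.
Qed.

Lemma L2_sum_null (Y : I -> T -> R) (Z : T -> R) : L2_sum P Y Z ->
  L2_null (fun A w => Z w - \sum_(i <- A) Y i w).
Proof.
move=> YZ tau tau0.
have : nbhs 0%E [set x : \bar R | (x < tau%:E)%E].
  by apply: open_nbhs_nbhs; split;
    [exact: open_ereal_lt_ereal|rewrite /= lte_fin].
move=> /YZ[B _ HB]; exists B => A /HB /=.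
by rewrite unlock => /ltW.
Qed.

End L2Approximation.

Lemma esumZl {R : realType} {I : choiceType} (k : R) (F : I -> R) : 0 < k ->
  (forall i, 0 <= F i) ->
  (\esum_(i in [set: I]) (k * F i)%:E =
    k%:E * \esum_(i in [set: I]) (F i)%:E)%E.
Proof.
move=> k0 F0; rewrite /esum -ereal_sup_pZl//; congr ereal_sup.
rewrite image_comp; apply: eq_imagel => X [finX _] /=.
rewrite ge0_mule_fsumr; first by apply: eq_fsbigr.
by move=> i; rewrite lee_fin.
Qed.

Lemma asymp_eq_near {R : realType} (u v v' : nat -> \bar R) :
  (\forall n \near \oo, v n = v' n) -> asymp_eq u v -> asymp_eq u v'.
Proof.
move=> vv' [e e0 ue]; exists e => //.
by apply: filterS2 vv' ue => n <-.
Qed.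

(** * Asymptotic equivalence *)
Lemma asymp_eq_ratio {R : realType} (p : nat -> R) (v : nat -> \bar R) :
  (forall eta : R, 0 < eta -> eta < 1 -> \forall n \near \oo,
    exists2 V : R, 0 < V & v n = V%:E /\ (1 - eta) * V <= p n <= (1 + eta) * V)
      ->
  asymp_eq (fun n => (p n)%:E) v.
Proof.
move=> H; exists (fun n => p n / fine (v n) - 1).
  apply/cvgrPdist_le => eps eps0.
  pose eta := Num.min eps 2^-1.
  have eta0 : 0 < eta by rewrite lt_min eps0 invr_gt0 ltr0n.
  have eta1 : eta < 1 by rewrite gt_min invf_lt1// ltr1n orbT.
  have etae : eta <= eps by rewrite ge_min lexx.
  apply: filterS (H _ eta0 eta1) => n [V V0 [-> /andP[le1 le2]]] /=.
  rewrite sub0r normrN ler_norml.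
  rewrite -ler_pdivlMr// in le1; rewrite -ler_pdivrMr// in le2.
  by apply/andP; split; lra.
apply: filterS (H 2^-1 _ _); [|by rewrite invr_gt0|by rewrite invf_lt1// ltr1n].
move=> n [V V0 [-> _]] /=.
by rewrite -EFinM subrKC divfK// gt_eqF.
Qed.

(** [50 / 9] is the constant for which [(1 - delta) * C >= 5] when
    [delta <= 1 / 10].  It follows from [expR (t / 2) >= 2], [t + 2 >= 4] and
    [Num.sqrt 2 <= 36 / 25]. *)
Lemma constant_ge {R : realType} (t : R) : 2 < t ->
  50 / 9 <= expR (t / 2) * (t + 2) / Num.sqrt 2.
Proof.
move=> t2; have s0 : 0 < Num.sqrt 2 :> R by rewrite sqrtr_gt0.
rewrite ler_pdivlMr//.
have s2 : Num.sqrt 2 <= 36 / 25 :> R.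
  by rewrite -[leRHS]ger0_norm// -sqrtr_sqr ler_sqrt//; lra.
have e2 : 2 <= expR (t / 2) by apply: le_trans (expR_ge1Dx _); lra.
apply: (@le_trans _ _ (2 * (t + 2))); first by lra.
by rewrite ler_pM2r//; lra.
Qed.

(** * Normalised coefficients *)
Section Coefficients.
Context {R : realType}.
Variables (a : Z2 -> R) (Gamma : nat -> {fset Z2}) (n : nat) (t : R).
Hypothesis sigma_gt0 : 0 < sigma a Gamma n.
Hypothesis coef_gt0 : forall rs, 0 < coef a Gamma n rs.
Hypothesis t_gt2 : 2 < t.

Let s := sigma a Gamma n.
Let b := coef a Gamma n.
Definition weight rs := b rs / s.

Lemma weight_gt0 rs : 0 < weight rs. Proof. exact: divr_gt0. Qed.

Let D2E : coef_D a Gamma n 2 = s ^+ 2.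
Proof.
rewrite /s /sigma sqr_sqrtr//; move: sigma_gt0; rewrite /sigma.
by case: (leP 0 (coef_D a Gamma n 2)) => // /ltW/ler0_sqrtr ->; rewrite ltxx.
Qed.

Let coefE rs r : `|b rs| `^ r = s `^ r * weight rs `^ r.
Proof.
rewrite -powRM ?(ltW sigma_gt0) ?(ltW (weight_gt0 rs))// /weight ger0_norm
  ?ltW//.
by rewrite mulrC divfK// gt_eqF.
Qed.

Let esum_coefE r : (\esum_(rs in [set: Z2]) (`|b rs| `^ r)%:E =
  (s `^ r)%:E * \esum_(rs in [set: Z2]) (weight rs `^ r)%:E)%E.
Proof.
under eq_esum do rewrite coefE.
by rewrite esumZl ?powR_gt0// => rs; exact: powR_ge0.
Qed.

(** Positivity of [sigma] also excludes that the sum of squares diverges, since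
    [fine] sends an infinite sum to 0. *)
Lemma weight_sq : (\esum_(rs in [set: Z2]) (weight rs ^+ 2)%:E = 1%:E)%E.
Proof.
have E2 := esum_coefE 2; have := D2E; rewrite /coef_D E2.
under eq_esum do rewrite powR_mulrn ?(ltW (weight_gt0 _))//.
have s20 : 0 < s `^ 2 by exact: powR_gt0.
have ge0 : (0 <= \esum_(rs in [set: Z2]) (weight rs ^+ 2)%:E)%E.
  by apply: esum_ge0 => rs _; rewrite lee_fin sqr_ge0.
case: (\esum_(_ in _) _) ge0 => [r| |]//= _.
  rewrite powR_mulrn ?ltW// => /(congr1 (fun x => x / s ^+ 2)).
  rewrite mulrAC !divff ?mul1r ?gt_eqF ?exprn_gt0// => ->.
  by [].
rewrite gt0_muley ?lte_fin//= => /eqP; rewrite eq_sym sqrf_eq0 gt_eqF//.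
Qed.

Lemma weight_le1 rs : weight rs <= 1.
Proof.
have := fset_sum_le_esum weight_sq [fset rs]%fset.
rewrite big_seq_fset1 -[leRHS](expr1n _ 2) ler_pXn2r// nnegrE ?ler01//.
exact: ltW (weight_gt0 rs).
Qed.

Lemma weight_U : (\esum_(rs in [set: Z2]) (weight rs `^ t)%:E =
   (coef_U a Gamma n t)%:E)%E.
Proof.
have fin : (\esum_(rs in [set: Z2]) (weight rs `^ t)%:E <= 1%:E)%E.
  rewrite -weight_sq; apply: le_esum => rs _; rewrite lee_fin.
  rewrite -powR_mulrn ?(ltW (weight_gt0 rs))//; apply: ger_powR;
    last exact: ltW.
  by rewrite weight_gt0 weight_le1.
have ge0 : (0 <= \esum_(rs in [set: Z2]) (weight rs `^ t)%:E)%E.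
  by apply: esum_ge0 => rs _; rewrite lee_fin powR_ge0.
rewrite /coef_U D2E /coef_D esum_coefE.
case: (\esum_(_ in _) _) fin ge0 => [r| |]//= _ _.
rewrite -powR_mulrn ?(ltW sigma_gt0)// -powRrM mulrA -powRD; last first.
  by apply/implyP => _; rewrite gt_eqF.
have -> : 2%:R * - (t / 2) + t = 0 by field.
by rewrite powRr0 mul1r.
Qed.

Lemma coef_U_gt0 : 0 < coef_U a Gamma n t.
Proof.
apply: (@lt_le_trans _ _ (weight 0 `^ t)); first exact/powR_gt0/weight_gt0.
by have := fset_sum_le_esum weight_U [fset 0]%fset; rewrite big_seq_fset1.
Qed.

Lemma weight_le_rho rs : weight rs ^+ 2 <= rho2 a Gamma n.
Proof.
rewrite /rho2; have -> : weight rs ^+ 2 =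
  coef a Gamma n rs ^+ 2 / sigma a Gamma n ^+ 2.
  by rewrite /weight exprMn exprVn.
apply: sup_upper_bound; last by exists rs.
split; first by exists (coef a Gamma n rs ^+ 2 / sigma a Gamma n ^+ 2), rs.
exists 1 => _ [r _ <-].
rewrite -exprVn -exprMn -[leRHS](expr1n _ 2) ler_pXn2r ?nnegrE ?ler01//.
  exact: weight_le1.
exact: ltW (weight_gt0 r).
Qed.

End Coefficients.

(** Shifting the summation index by [jk] centres all the expansions at the same
    innovations. *)
Lemma field_L2_null {d : measure_display} {R : realType}
  {Omega : measurableType d}
    {P : probability Omega R} (a : Z2 -> R) (xi : Z2 -> {RV P >-> R})
    (X : Z2 -> {RV P >-> R}) (jk : Z2) :
  L2_sum P (fun (rs : Z2) w => a rs * xi (jk - rs) w) (X jk) ->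
  L2_null (P := P) (fun A w =>
    X jk w - \sum_(rs <- A) a (jk + rs) * xi (- rs) w).
Proof.
move=> /L2_sum_null nX tau /nX [B HB].
exists [fset (rs - jk)%R | rs in B]%fset => A BA.
have /HB : (B `<=` [fset (jk + rs)%R | rs in A])%fset.
  apply/fsubsetP => rs rsB; apply/imfsetP; exists (rs - jk);
    last by rewrite addrC subrK.
  by apply: (fsubsetP BA); exact: in_imfset.
congr (_ <= _)%E; apply: eq_integral => w _; congr ((_ - _) ^+ 2)%:E.
rewrite big_imfset/=; last by move=> r r' _ _; exact: addrI.
by apply: eq_bigr => rs _; rewrite opprD addrA subrr add0r.
Qed.

Lemma partial_sum_L2_null {d : measure_display} {R : realType}
  {Omega : measurableType d}
    {P : probability Omega R} (a : Z2 -> R) (xi : Z2 -> {RV P >-> R})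
    (X : Z2 -> {RV P >-> R}) (Gamma : nat -> {fset Z2}) (n : nat) :
  (forall jk, L2_sum P (fun (rs : Z2) w => a rs * xi (jk - rs) w) (X jk)) ->
  L2_null (P := P) (fun A w => \sum_(jk <- Gamma n) X jk w -
    \sum_(rs <- A) coef a Gamma n rs * xi (- rs) w).
Proof.
move=> X_field.
have mD jk A : measurable_fun setT
    (fun w => X jk w - \sum_(rs <- A) a (jk + rs) * xi (- rs) w).
  by apply: measurable_funB => //; apply: measurable_sum => rs;
    exact: measurable_funM.
have := L2_null_sum (enum_fset (Gamma n)) mD
  (fun jk => field_L2_null (X_field jk)).
move=> H tau /H [B HB]; exists B => A /HB.
congr (_ <= _)%E; apply: eq_integral => w _; congr (_ ^+ 2)%:E.
rewrite sumrB; congr (_ - _); rewrite exchange_big/=; apply: eq_bigr => rs _.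
by rewrite mulr_suml.
Qed.

(** * Exact asymptotics of the tail of the partial sums *)
Theorem theorem2p2 (R : realType) (d : measure_display)
    (Omega : measurableType d) (P : probability Omega R)
    (a : Z2 -> R) (xi : Z2 -> {RV P >-> R}) (xi0 : {RV P >-> R})
    (X : Z2 -> {RV P >-> R}) (Gamma : nat -> {fset Z2})
    (t : R) (h : R -> R) (C_t : R) (x : nat -> R)
    (a_sqsum : (\esum_(rs in [set: Z2]) (a rs ^+ 2)%:E < +oo)%E)
    (xi_iid : iid (oapp xi xi0))
    (xi0_mean : ('E_P[xi0] = 0)%E)
    (xi0_var : ('E_P[fun w => (xi0 w ^+ 2)%R] = 1)%E)
    (X_field : forall jk : Z2,
       L2_sum P (fun (rs : Z2) w => a rs * xi (jk - rs) w) (X jk))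
    (sigma_gt0 : forall n, 0 < sigma a Gamma n)
    (coef_gt0 : forall n rs, 0 < coef a Gamma n rs)
    (rho2_to0 : rho2 a Gamma n @[n --> \oo] --> (0 : R))
    (t_gt2 : 2 < t)
    (h_sv : slowly_varying h)
    (xi0_tail : \forall y \near +oo,
       P [set w | y <= xi0 w] = (h y / y `^ t)%:E)
    (C_t_gt : expR (t / 2) * (t + 2) / Num.sqrt 2 < C_t)
    (x_ge : forall n,
       C_t * Num.sqrt (ln (coef_U a Gamma n t)^-1) <= x n / sigma a Gamma n) :
  asymp_eq
    (fun n => P [set w | x n <= \sum_(jk <- Gamma n) X jk w])
    (fun n => \esum_(rs in [set: Z2])
       P [set w | x n <= coef a Gamma n rs * xi (- rs) w])
  /\
  asymp_eq
    (fun n => P [set w | x n <= \sum_(jk <- Gamma n) X jk w])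
    (fun n => ((x n `^ (- t))%:E * \esum_(rs in [set: Z2])
       (coef a Gamma n rs `^ t * h (x n / coef a Gamma n rs))%R%:E)%E).
Proof.
pose Y (rs : Z2) := xi (- rs).
pose G u := fine (P [set w | u <= xi0 w]).
have indepY : mutually_independent Y.
  apply: (mutually_independent_comp (Y := oapp xi xi0)
    (f := fun rs : Z2 => Some (- rs))).
    by move=> r r' /Some_inj/oppr_inj.
  by case: xi_iid.
have law rs A : measurable A -> distribution P xi0 A = distribution P (Y rs) A.
  by move=> mA; have [_ /(_ None (Some (- rs)) A mA)] := xi_iid.
have mxi0 : measurable_fun setT xi0 by [].
have mxi02 : measurable_fun setT (fun w => xi0 w ^+ 2) by exact:
  measurable_funX.
have m2 : measurable_fun [set: R] (fun u => u ^+ 2) by exact: exprn_measurable.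
have int2 : P.-integrable setT (fun w => (xi0 w ^+ 2)%:E).
  apply/integrableP; split; first exact/measurable_EFinP.
  under eq_integral do rewrite gee0_abs ?lee_fin ?sqr_ge0//.
  by move: xi0_var; rewrite unlock => ->; rewrite ltry.
have int1 : P.-integrable setT (fun w => (xi0 w)%:E).
  apply: (@le_integrable _ _ _ _ _ measurableT _
    (fun w => (1 + xi0 w ^+ 2)%:E)).
  - exact/measurable_EFinP.
  - move=> w _; rewrite /= !lee_fin [leRHS]ger0_norm ?addr_ge0 ?sqr_ge0//.
    by rewrite ler_norml; apply/andP; split; nra.
  - apply: (integrableD measurableT
    (finite_measure_integrable_cst P 1 measurableT) int2).
have mean0 : \int[P]_w xi0 w = 0.
  by rewrite /Rintegral; move: xi0_mean; rewrite unlock => ->.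
have var1 : \int[P]_w (xi0 w ^+ 2) = 1.
  by rewrite /Rintegral; move: xi0_var; rewrite unlock => ->.
have intY rs : P.-integrable setT (fun w => (Y rs w)%:E).
  exact: (integrable_same_law (law rs) (f := fun u => u)).
have intY2 rs : P.-integrable setT (fun w => (Y rs w ^+ 2)%:E).
  exact: (integrable_same_law (law rs) (f := fun u => u ^+ 2)).
have meanY rs : \int[P]_w Y rs w = 0.
  by rewrite -(Rintegral_same_law (law rs) (f := fun u => u)).
have varY rs : \int[P]_w (Y rs w ^+ 2) = 1.
  by rewrite -(Rintegral_same_law (law rs) (f := fun u => u ^+ 2)).
have mtail u : measurable [set w | u <= xi0 w] by exact: measurable_superlevel.
have lawY rs u : P [set w | u <= Y rs w] = (G u)%:E.
  rewrite /G fine_prK//; apply/esym/(law rs [set v | u <= v]).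
  by apply: measurable_superlevel; exact: measurable_id.
have G_tail rs u : fine (P [set w | u <= Y rs w]) = G u by rewrite lawY.
have G_noninc : {homo G : u v / u <= v >-> v <= u}.
  by move=> u v uv; apply: le_pr => // w /=; exact: le_trans.
have G_le1 u : G u <= 1.
  by rewrite -lee_fin fine_prK//; exact: probability_le1.
have G_near : \forall y \near +oo, G y = h y / y `^ t.
  by apply: filterS xi0_tail => y; rewrite /G => ->.
have [M [_ GE]] := G_near.
have [_ h_gt0 _] := h_sv.
have G_gt0 u : 0 < G u.
  pose v := Num.max u (Num.max M 0 + 1).
  apply: (@lt_le_trans _ _ (G v)); last by apply: G_noninc; rewrite le_max lexx.
  have vM : Num.max M 0 < v by rewrite lt_max ltrDl ltr01 orbT.
  move: vM; rewrite gt_max => /andP[vM v0].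
  by rewrite GE// divr_gt0 ?powR_gt0// h_gt0.
have G_rv : regularly_varying_tail G t.
  exact: slowly_varying_tail h_sv G_near.
have C9 : 50 / 9 <= C_t by apply: le_trans (ltW C_t_gt); exact: constant_ge.
pose p n := fine (P [set w | x n <= \sum_(jk <- Gamma n) X jk w]).
have mS n : measurable_fun setT (fun w => \sum_(jk <- Gamma n) X jk w).
  exact: measurable_sum.
have pE n : P [set w | x n <= \sum_(jk <- Gamma n) X jk w] = (p n)%:E.
  by rewrite /p fine_prK//; exact: measurable_superlevel.
have targetE n : \esum_(rs in [set: Z2])
    P [set w | x n <= coef a Gamma n rs * xi (- rs) w] =
    \esum_(rs in [set: Z2]) (G (x n / coef a Gamma n rs))%:E.
  apply: eq_esum => rs _; rewrite -(lawY rs); congr (P _).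
  by apply/seteqP; split => w /=; rewrite ler_pdivrMr// mulrC.
have key eta u_min : 0 < eta -> eta < 1 -> \forall n \near \oo,
    exists2 V : R, 0 < V & [/\ \esum_(rs in [set: Z2])
        P [set w | x n <= coef a Gamma n rs * xi (- rs) w] = V%:E,
      (forall rs, u_min <= x n / coef a Gamma n rs) &
      (1 - eta) * V <= p n <= (1 + eta) * V].
  move=> eta0 eta1.
  have [kappa k0 Hk] := single_big_jump indepY intY intY2 meanY varY G_tail
    G_noninc G_gt0 G_le1 G_rv t_gt2 C9 eta0 eta1 u_min.
  have : \forall n \near \oo, rho2 a Gamma n < kappa ^+ 2.
    by apply: (cvgr_lt _ rho2_to0); rewrite exprn_gt0.
  apply: filterS => n rho_lt.
  have s0 := sigma_gt0 n; have b0 := coef_gt0 n.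
  have ratioE rs : x n / sigma a Gamma n / weight a Gamma n rs =
    x n / coef a Gamma n rs.
    by rewrite /weight; field; rewrite !gt_eqF.
  pose Z w := (\sum_(jk <- Gamma n) X jk w) / sigma a Gamma n.
  have ZE : [set w | x n / sigma a Gamma n <= Z w] =
      [set w | x n <= \sum_(jk <- Gamma n) X jk w].
    by apply/seteqP; split => w /=; rewrite /Z ler_pM2r ?invr_gt0.
  have [] := Hk (weight a Gamma n) (x n / sigma a Gamma n) (coef_U a Gamma n t)
    Z.
  - by move=> rs; exact: weight_gt0.
  - move=> rs; rewrite -(ler_pXn2r (n := 2))// ?nnegrE ?(ltW k0)
    ?(ltW (weight_gt0 s0 b0 rs))//.
    exact: le_trans (weight_le_rho s0 b0 rs) (ltW rho_lt).
  - exact: weight_sq.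
  - exact: weight_U.
  - exact: coef_U_gt0.
  - exact: x_ge.
  - exact: measurable_funM.
  - move=> tau B tau0.
    have tau' : 0 < tau * sigma a Gamma n ^+ 2 by rewrite mulr_gt0// exprn_gt0.
    have [B' HB'] := partial_sum_L2_null Gamma n X_field tau'.
    exists (B `|` B')%fset; first exact: fsubsetUl.
    have := HB' (B `|` B')%fset (fsubsetUr _ _).
    set A := (B `|` B')%fset => le_tau.
    have -> : (\int[P]_w ((Z w - \sum_(i <- A) weight a Gamma n i * Y i w) ^+
      2)%:E =
       (sigma a Gamma n ^- 2)%:E * \int[P]_w ((\sum_(jk <- Gamma n) X jk w -
         \sum_(rs <- A) coef a Gamma n rs * xi (- rs) w) ^+ 2)%:E)%E.
      rewrite -ge0_integralZl//; last 3 first.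
      + apply/measurable_EFinP; apply: measurable_funX;
        apply: measurable_funB => //.
        by apply: measurable_sum => rs; exact: measurable_funM.
      + by move=> w _; rewrite lee_fin sqr_ge0.
      + by rewrite lee_fin invr_ge0 sqr_ge0.
      apply: eq_integral => w _; rewrite -EFinM; congr EFin.
      rewrite -exprVn -exprMn mulrBr mulrC; congr ((_ - _) ^+ 2).
      by rewrite mulr_sumr; apply: eq_bigr => rs _; rewrite /weight /Y; ring.
    have -> : tau%:E = ((sigma a Gamma n ^- 2)%:E *
      (tau * sigma a Gamma n ^+ 2)%:E)%E.
      by rewrite -EFinM; congr EFin; field; rewrite gt_eqF.
    by rewrite lee_pmul2l// lte_fin invr_gt0 exprn_gt0.
  move=> V V0 [VE ratio_ge bounds]; exists V => //; split.
  - by rewrite targetE -VE; apply: eq_esum => rs _; rewrite ratioE.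
  - by move=> rs; rewrite -ratioE.
  - by move: bounds; rewrite ZE.
have first : asymp_eq
    (fun n => P [set w | x n <= \sum_(jk <- Gamma n) X jk w])
    (fun n => \esum_(rs in [set: Z2])
       P [set w | x n <= coef a Gamma n rs * xi (- rs) w]).
  under eq_fun do rewrite pE.
  apply: asymp_eq_ratio => eta eta0 eta1.
  by apply: filterS (key eta 0 eta0 eta1) => n [V V0 [VE _ bounds]]; exists V.
split; first exact: first.
(* For large n all arguments x n / b lie where the tail is given by h. *)
apply: asymp_eq_near first.
have half0 : 0 < 2^-1 :> R by rewrite invr_gt0.
have half1 : 2^-1 < 1 :> R by rewrite invf_lt1// ltr1n.
apply: filterS (key 2^-1 (Num.max M 0 + 1) half0 half1) =>
  n [_ _ [_ ratio_ge _]].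
have b0 := coef_gt0 n.
have ratio rs : M < x n / coef a Gamma n rs /\ 0 < x n / coef a Gamma n rs.
  have : Num.max M 0 < x n / coef a Gamma n rs.
    by apply: lt_le_trans (ratio_ge rs); rewrite ltrDl.
  by rewrite gt_max => /andP[].
have x0 : 0 < x n by have [_] := ratio 0; rewrite pmulr_lgt0// invr_gt0.
rewrite targetE -esumZl ?powR_gt0//; last first.
  by move=> rs; rewrite mulr_ge0 ?powR_ge0// ltW// h_gt0//; have [] := ratio rs.
apply: eq_esum => rs _; congr EFin; have [ratioM _] := ratio rs.
rewrite GE// powRM ?invr_ge0 ?(ltW x0) ?(ltW (b0 rs))//.
rewrite -[_^-1]powR_inv1 ?(ltW (b0 rs))// -powRrM mulN1r !powRN.
by field; rewrite !gt_eqF ?powR_gt0.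
Qed.
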